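(* The $k$-DMLOB problem restricted to digraphs in $\mathcal{L}$ is fixed parameter tractable: there is an algorithm which, given a digraph $D\in\mathcal{L}$ of order $n$ and a positive integer $k$, decides whether $\ell_s(D)\ge k$ in time $f(k)\, n^{O(1)}$ for some computable function $f$ depending only on $k$.
   Context: Digraphs are finite, without loops or parallel arcs. An out-tree of a digraph $D$ is a subdigraph $T$ that is an oriented tree with exactly one vertex of in-degree zero (the root); its leaves are its vertices of out-degree zero. An out-branching of $D$ is an out-tree $T$ with $V(T)=V(D)$. $\ell(D)$ denotes the maximum number of leaves of an out-tree of $D$, and $\ell_s(D)$ the maximum number of leaves of an out-branching of $D$, with $\ell_s(D)=0$ if $D$ has no out-branching. $\mathcal{L}$ is the family of digraphs $D$ for which either $\ell_s(D)=0$ or $\ell_s(D)=\ell(D)$. The $k$-DMLOB problem: given a digraph $D$ and a positive integer parameter $k$, decide whether $\ell_s(D)\ge k$. *)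

(* Defs.v *)
From mathcomp Require Import all_boot.

Set Implicit Arguments.
Unset Strict Implicit.
Unset Printing Implicit Defensive.

Record digraph (V : finType) := Digraph {
  arc :> rel V;
  arc_irr : irreflexive arc
}.

(* A pair (vertex set, arc set) on V; it is a digraph only under [subdigraph]. *)
Definition graph_data (V : finType) : finType := ({set V} * {set V * V})%type.

Section OutTrees.
Variable V : finType.
Implicit Types (D : digraph V) (T : graph_data V).

Definition subdigraph D T : bool :=
  [forall a in T.2, [&& arc D a.1 a.2, a.1 \in T.1 & a.2 \in T.1]].

Definition indeg T (x : V) : nat := #|[set y | (y, x) \in T.2]|.
Definition outdeg T (x : V) : nat := #|[set y | (x, y) \in T.2]|.

Definition underlying T : rel V :=
  fun x y => ((x, y) \in T.2) || ((y, x) \in T.2).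

Definition oriented T : bool :=
  [forall a in T.2, (a.2, a.1) \notin T.2].

Definition connected T : bool :=
  (T.1 != set0) && [forall x in T.1, forall y in T.1, connect (underlying T) x y].

(* [ucycleb] holds of any repetition-free closed sequence, including those of
   size at most 2, which are not cycles of a simple graph.  A repetition-free
   sequence has size at most #|V|, so bounding m loses nothing. *)
Definition acyclic T : bool :=
  [forall m : 'I_#|V|.+1, forall c : m.-tuple V,
     ucycleb (underlying T) c ==> (m <= 2)].

Definition oriented_tree T : bool := [&& oriented T, connected T & acyclic T].

Definition out_tree D T : bool :=
  [&& subdigraph D T, oriented_tree T
    & #|[set x in T.1 | indeg T x == 0]| == 1].

Definition out_branching D T : bool := out_tree D T && (T.1 == [set: V]).

Definition leaves T : {set V} := [set x in T.1 | outdeg T x == 0].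

(* A maximum over the empty range is 0, so [ell_s D = 0] when D has no
   out-branching. *)
Definition ell D : nat := \max_(T : graph_data V | out_tree D T) #|leaves T|.
Definition ell_s D : nat :=
  \max_(T : graph_data V | out_branching D T) #|leaves T|.

Definition family_L D : Prop := ell_s D = 0 \/ ell_s D = ell D.

End OutTrees.

(* Algorithms are programs for the uniform-cost random access machine of Cook
   and Reckhow (no multiplication, hence polynomially equivalent to Turing
   machines), over natural numbers with truncated subtraction.  The input is a
   tape of naturals consumed by [Read]; all registers are initially 0. *)
Inductive instr :=
| Const of nat & nat          (* X_i <- c *)
| Add of nat & nat & nat      (* X_i <- X_j + X_l *)
| Sub of nat & nat & nat      (* X_i <- X_j - X_l *)
| Fetch of nat & nat           (* X_i <- X_(X_j) *)
| Store of nat & nat          (* X_(X_i) <- X_j *)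
| Jpos of nat & nat           (* go to instruction m if X_j > 0 *)
| Read of nat.                (* X_i <- next input, or 0 if there is none *)

Definition program := seq instr.

Record config := Config { pc : nat; reg : nat -> nat; tape : seq nat }.

Definition upd (r : nat -> nat) (i v : nat) : nat -> nat :=
  fun j => if j == i then v else r j.

Definition exec (a : instr) (s : config) : config :=
  let: Config q r u := s in
  match a with
  | Const i c => Config q.+1 (upd r i c) u
  | Add i j l => Config q.+1 (upd r i (r j + r l)) u
  | Sub i j l => Config q.+1 (upd r i (r j - r l)) u
  | Fetch i j => Config q.+1 (upd r i (r (r j))) u
  | Store i j => Config q.+1 (upd r (r i) (r j)) u
  | Jpos m j => Config (if 0 < r j then m else q.+1) r u
  | Read i => Config q.+1 (upd r i (head 0 u)) (behead u)
  end.

(* The machine halts when the program counter leaves the program; a halted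
   configuration is a fixed point of [step]. *)
Definition halted (p : program) (s : config) : bool := size p <= pc s.

Definition step (p : program) (s : config) : config :=
  if onth p (pc s) is Some a then exec a s else s.

Definition run (p : program) (x : seq nat) (t : nat) : config :=
  iter t (step p) (Config 0 (fun=> 0) x).

(* On input x, p halts after at most t steps with output y in X_0. *)
Definition outputs_within (p : program) (x : seq nat) (t y : nat) : Prop :=
  halted p (run p x t) /\ reg (run p x t) 0 = y.

Definition computable (f : nat -> nat) : Prop :=
  exists p : program, forall k, exists t, outputs_within p [:: k] t (f k).

(* The order, the parameter, then the adjacency matrix in row-major order. *)
Definition encode (n : nat) (D : digraph 'I_n) (k : nat) : seq nat :=
  n :: k :: [seq nat_of_bool (D i j) | i <- enum 'I_n, j <- enum 'I_n].

(* Main.v *)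
From mathcomp Require Import all_boot zify.
Require Import Defs.

Set Implicit Arguments.
Unset Strict Implicit.
Unset Printing Implicit Defensive.

(* For D in L and k > 0, ell_s D >= k iff some vertex reaches all others and
   ell D >= k.  An out-tree with k >= 2 leaves exists iff there are a root r and
   a set I of vertices, all reachable from r inside D[I], such that at least k
   vertices outside I have a predecessor in I.

   Such an I is found by the branching of Kneis, Langer and Rossmanith: grow I
   from r, and for each vertex on its border guess whether it stays outside for
   good or joins I.  If a vertex joins and discovers exactly one new vertex w,
   then w may be assumed to join too, since otherwise the vertex could have been
   left outside without loss.  A vertex left outside for good costs one bit and
   so does every increase of the border, hence 2k bits suffice, and the 4^k
   guesses are enumerated as the numbers h < 4^k. *)

(** * Structured programs *)

(** Membership in L is what makes a non-spanning out-tree useful: as soon as an out-branching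
    exists, some out-branching has as many leaves as any out-tree. The bound [k >= 2] is needed
    because a one-vertex tree has a leaf while its root has no boundary to offer.

    Why leaving a vertex v outside is without loss: if v discovers at most one vertex and I contains
    no vertex that v discovers, then deleting v from I loses at most one boundary vertex and gains v
    itself. So a vertex that lies in every suitable I discovers at least one vertex, and a chain of
    forced vertices ends in one that discovers two or more, which raises the border.

    The number 2k bounds the potential (k - red) + (k - border), where red counts the vertices left
    outside for good; each bit lowers it by at least one. Instead of keeping a stack of branchings,
    the machine replays the search from scratch for each h, reading bits by doubling h and comparing
    with 4^k. *)

Inductive cmd :=
| Skip
| Ins of instr
| Seq of cmd & cmd
| Ite of nat & cmd & cmd
| While of nat & cmd.

Notation "c1 ;; c2" := (Seq c1 c2) (at level 61, right associativity).

Fixpoint csize (c : cmd) : nat :=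
  match c with
  | Skip => 0
  | Ins _ => 1
  | c1 ;; c2 => csize c1 + csize c2
  | Ite _ c1 c2 => csize c1 + csize c2 + 2
  | While _ c1 => csize c1 + 3
  end.

(* Jumps are absolute, so the code depends on its offset [o].  An unconditional
   jump tests register 1, which every program keeps equal to 1. *)
Fixpoint compile (o : nat) (c : cmd) : program :=
  match c with
  | Skip => [::]
  | Ins a => [:: a]
  | c1 ;; c2 => compile o c1 ++ compile (o + csize c1) c2
  | Ite x c1 c2 =>
      Jpos (o + csize c2 + 2) x :: compile o.+1 c2 ++
      Jpos (o + csize c1 + csize c2 + 2) 1 :: compile (o + csize c2 + 2) c1
  | While x c1 =>
      Jpos (o + 2) x :: Jpos (o + csize c1 + 3) 1 ::
      compile (o + 2) c1 ++ [:: Jpos o 1]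
  end.

Lemma size_compile (c : cmd) (o : nat) : size (compile o c) = csize c.
Proof.
elim: c o => //= [c1 IH1 c2 IH2 | x c1 IH1 c2 IH2 | x c IH] o;
  rewrite size_cat /= ?IH1 ?IH2 ?IH; lia.
Qed.

Local Arguments onth : simpl never.

Fixpoint code_at (p : program) (o : nat) (l : program) : Prop :=
  if l is a :: l' then onth p o = Some a /\ code_at p o.+1 l' else True.

Lemma code_at_cat (p : program) (o : nat) (l1 l2 : program) :
  code_at p o (l1 ++ l2) <-> code_at p o l1 /\ code_at p (o + size l1) l2.
Proof.
elim: l1 o => [|a l1 IH] o /=; first by rewrite addn0; split=> [|[]].
rewrite IH addSnnS; tauto.
Qed.

Lemma code_at_self (p q : program) : code_at (q ++ p) (size q) p.
Proof.
elim: p q => //= a p IH q; split; last first.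
  by rewrite -cat_rcons; have := IH (rcons q a); rewrite size_rcons.
by elim: q.
Qed.

Definition is_jump (a : instr) : bool := if a is Jpos _ _ then true else false.

Definition effect (a : instr) (r : nat -> nat) (u : seq nat) :
    (nat -> nat) * seq nat :=
  match a with
  | Const i c => (upd r i c, u)
  | Add i j l => (upd r i (r j + r l), u)
  | Sub i j l => (upd r i (r j - r l), u)
  | Fetch i j => (upd r i (r (r j)), u)
  | Store i j => (upd r (r i) (r j), u)
  | Jpos _ _ => (r, u)
  | Read i => (upd r i (head 0 u), behead u)
  end.

Lemma exec_effect (a : instr) (q : nat) (r : nat -> nat) (u : seq nat) :
  ~~ is_jump a ->
  exec a (Config q r u) = Config q.+1 (effect a r u).1 (effect a r u).2.
Proof. by case: a. Qed.

Lemma step_at (p : program) (q : nat) (a : instr) (r : nat -> nat) u :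
  onth p q = Some a -> step p (Config q r u) = exec a (Config q r u).
Proof. by rewrite /step [pc _]/= => ->. Qed.

(** Timed total correctness. Quantifying over all programs that contain the code at some offset is
    what lets the rules compose. *)
Definition wp (c : cmd) (T : nat) (Q : (nat -> nat) -> seq nat -> Prop)
    (r : nat -> nat) (u : seq nat) : Prop :=
  forall (p : program) (o : nat), code_at p o (compile o c) ->
  exists t r' u', [/\ t <= T,
    iter t (step p) (Config o r u) = Config (o + csize c) r' u' & Q r' u'].

(** * Proof rules for timed total correctness *)

Section WpRules.
Implicit Types (Q : (nat -> nat) -> seq nat -> Prop) (r : nat -> nat).
Implicit Types (u : seq nat) (T x : nat) (c : cmd).

Lemma wp_weaken c T T' Q Q' r u :
  wp c T Q r u -> T <= T' -> (forall r' u', Q r' u' -> Q' r' u') ->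
  wp c T' Q' r u.
Proof.
move=> H leT QQ' p o Hp; have [t [r' [u' [tT E /QQ' q]]]] := H p o Hp.
by exists t, r', u'; split=> //; apply: leq_trans leT.
Qed.

Lemma wp_skip T Q r u : Q r u -> wp Skip T Q r u.
Proof. by move=> q p o _; exists 0, r, u; rewrite /= addn0. Qed.

Lemma wp_ins a T Q r u :
  ~~ is_jump a -> 0 < T -> Q (effect a r u).1 (effect a r u).2 ->
  wp (Ins a) T Q r u.
Proof.
move=> nj T0 q p o /= [E _]; exists 1, (effect a r u).1, (effect a r u).2.
by split; rewrite // iterS (step_at _ _ E) exec_effect // addn1.
Qed.

Lemma wp_seq T1 Q1 c1 c2 T Q r u :
  wp c1 T1 Q1 r u -> T1 <= T ->
  (forall r' u', Q1 r' u' -> wp c2 (T - T1) Q r' u') ->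
  wp (c1 ;; c2) T Q r u.
Proof.
move=> H1 leT H2 p o /= /code_at_cat [C1]; rewrite size_compile => C2.
have [t [r' [u' [tT E /H2 q]]]] := H1 p o C1.
have [t' [r'' [u'' [tT' E' q']]]] := q p _ C2.
exists (t' + t), r'', u''; split=> //; first lia.
by rewrite iterD E E' addnA.
Qed.

Lemma wp_inseq a c T Q r u :
  ~~ is_jump a -> 0 < T ->
  wp c T.-1 Q (effect a r u).1 (effect a r u).2 -> wp (Ins a ;; c) T Q r u.
Proof.
move=> nj T0 H; apply: (@wp_seq 1 (fun r' u' => wp c T.-1 Q r' u')) => //.
  exact: wp_ins.
by move=> r' u'; rewrite subn1.
Qed.

(** The code of [c2] comes first and leaves by a jump on register 1, so [Q] must guarantee that this
    register still holds 1. The 2 extra steps are the two jumps. *)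
Lemma wp_ite x c1 c2 T Q r u :
  r 1 = 1 -> (forall r' u', Q r' u' -> r' 1 = 1) -> 2 <= T ->
  (0 < r x -> wp c1 (T - 2) Q r u) -> (r x = 0 -> wp c2 (T - 2) Q r u) ->
  wp (Ite x c1 c2) T Q r u.
Proof.
move=> r1 Q1 T2 H1 H2 p o /= [J /code_at_cat [C2]].
rewrite size_compile /= => -[J2 C1].
case: (posnP (r x)) => [rx|rx].
  have [t [r' [u' [tT E q]]]] := H2 rx p _ C2.
  exists (1 + (t + 1)), r', u'; split=> //; first lia.
  rewrite iterD [iter (t + 1) _ _]iterD [iter 1 _ (Config o r u)]/=.
  rewrite (step_at _ _ J) /= rx E (step_at _ _ J2) /= (Q1 _ _ q) /=.
  congr Config; lia.
have C1' : code_at p (o + csize c2 + 2) (compile (o + csize c2 + 2) c1).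
  by rewrite {1}(_ : o + csize c2 + 2 = (o.+1 + csize c2).+1) //; lia.
have [t [r' [u' [tT E q]]]] := H1 rx p _ C1'.
exists (t + 1), r', u'; split=> //; first lia.
rewrite iterD [iter 1 _ _]/= (step_at _ _ J) /= rx E; congr Config; lia.
Qed.

Fixpoint downto (A : Type) (f : nat -> A -> A) (m : nat) (a : A) : A :=
  if m is m'.+1 then downto f m' (f m' a) else a.

(** The counter is decremented before the body, which therefore sees m-1, ..., 0, the order of
    [downto]. *)
Definition For (x : nat) (c : cmd) : cmd := While x (Ins (Sub x x 1) ;; c).

(** A simulation: [S] relates abstract states to machine states and must be insensitive to the
    counter, which changes outside the body. A round costs 3 steps besides the body (test,
    decrement, jump back), and the exit costs 2. *)
Lemma wp_for (A : Type) (f : nat -> A -> A)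
    (S : A -> (nat -> nat) -> seq nat -> Prop) x c T m a r u :
  (forall a r u, S a r u -> r 1 = 1) ->
  (forall a r u v, S a r u -> S a (upd r x v) u) ->
  (forall i a r u, i < m -> S a r u -> r x = i ->
     wp c T (fun r' u' => S (f i a) r' u' /\ r' x = i) r u) ->
  S a r u -> r x = m ->
  wp (For x c) (m * (T + 3) + 2) (fun r' u' => S (downto f m a) r' u') r u.
Proof.
move=> S1 Supd Hc Sa rx p o /= [J1 [J2 [J3 /code_at_cat [C [J4 _]]]]].
rewrite size_compile in J4.
have C' : code_at p (o + 2 + 1) (compile (o + 2 + 1) c).
  by rewrite (_ : o + 2 + 1 = o.+3) in C *; last lia.
elim: m a r u Hc Sa rx => [|m IH] a r u Hc Sa rx.
  exists 2, r, u; split=> //.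
  rewrite !iterS (step_at _ _ J1) /= rx (step_at _ _ J2) /= (S1 _ _ _ Sa) /=.
  congr Config; lia.
have Sa' : S a (upd r x m) u by apply: Supd.
have rx' : upd r x m x = m by rewrite /upd eqxx.
have [t [r' [u' [tT E [q rx'']]]]] := Hc m a _ _ (leqnn _) Sa' rx' p _ C'.
have Hc' i a0 r0 u0 : i < m -> S a0 r0 u0 -> r0 x = i ->
    wp c T (fun r' u' => S (f i a0) r' u' /\ r' x = i) r0 u0.
  by move=> im; apply: Hc; apply: ltnW.
have [t' [r'' [u'' [tT' E' q']]]] := IH _ _ _ Hc' q rx''.
exists (t' + (1 + (t + 2))), r'', u''; split=> //; first nia.
rewrite iterD [iter (1 + _) _ _]iterD [iter (t + 2) _ _]iterD.
rewrite [iter 2 _ _]/= (step_at _ _ J1) /= rx /= addn2 (step_at _ _ J3) /=.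
rewrite rx (S1 _ _ _ Sa) subn1 /= (_ : o.+3 = o + 2 + 1); last lia.
rewrite E (_ : o + 2 + 1 + csize c = o.+3 + csize c); last lia.
by rewrite (step_at _ _ J4) /= (S1 _ _ _ q) /= E'.
Qed.

Lemma step_halted p s : halted p s -> step p s = s.
Proof.
rewrite /halted /step => H; suff -> : onth p (pc s) = None by [].
by move: (pc s) H; elim: p => [|a p IH] [].
Qed.

(** Halted configurations are fixed points, so the steps left over after halting change nothing. *)
Lemma wp_outputs c T y u :
  wp c T (fun r _ => r 0 = y) (fun=> 0) u ->
  outputs_within (compile 0 c) u T y.
Proof.
move=> H; have := H (compile 0 c) 0 (code_at_self _ [::]).
move=> [t [r' [u' [tT E q]]]]; rewrite /outputs_within /run.
rewrite -(subnK tT) iterD E.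
have halt : halted (compile 0 c) (Config (0 + csize c) r' u').
  by rewrite /halted size_compile.
by elim: (T - t) => [|j [IH1 IH2]] //=; rewrite step_halted.
Qed.

End WpRules.

(** * The search procedure *)

Section Model.
Variables (n : nat) (adj : nat -> nat -> bool).
Implicit Types (st : nat -> nat) (v w cur h M : nat).

(* [st v] is 0 if v is unseen, 1 if v is a leaf that may still be expanded,
   2 if v is a leaf for good, 3 if v is internal.  A vertex register holds
   v.+1 for the vertex v, and 0 for none. *)
Definition search st : nat :=
  downto (fun i c => if st i == 1 then i.+1 else c) n 0.

Definition discover v w (s : (nat -> nat) * nat * nat) :=
  let: (st, c, l) := s in
  if adj v w && (st w == 0) then (upd st w 1, c.+1, w.+1) else s.

(** When [c <= 1], [l] is 0 if nothing was discovered and otherwise names the only discovered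
    vertex, so the second component is a forced vertex or none. *)
Definition expand st v : (nat -> nat) * nat :=
  let: (st', c, l) := downto (discover v) n (upd st v 3, 0, 0) in
  (st', if c <= 1 then l else 0).

(* One iteration: [cur] is a vertex that must be expanded; if there is none, the
   next bit of [h], most significant bit first, decides the fate of the vertex
   found by [search].  For M = 0 that bit is always 1. *)
Definition visit M (s : (nat -> nat) * nat * nat) :=
  let: (st, cur, h) := s in
  if 0 < cur then (expand st cur.-1, h)
  else if search st is v.+1 then
    if M <= h + h then (expand st v, h + h - M) else (upd st v 2, 0, h + h)
  else s.

Definition start v h : (nat -> nat) * nat * nat := (upd (fun=> 0) v 1, v.+1, h).

(** Here [n] rounds suffice: a round that is not idle turns a vertex of status 1 into one of status
    2 or 3, and such a vertex never changes again. *)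
Definition explore M v h : nat -> nat :=
  (downto (fun _ => visit M) n (start v h)).1.1.

Definition tally st : nat * nat :=
  downto (fun i c => (c.1 + (st i == 0), c.2 + (0 < st i < 3))) n (0, 0).

End Model.

(* Registers: 0 the output, and until the end the constant 0; 1 the constant 1;
   2 n; 3 k; 4 4^k; 5 "some vertex reaches all"; 6 "k leaves found"; 7 the root;
   8 the guess; 9 the address of the matrix; 10 cur; 11 h; 12 M; 14 and 15 the
   two components of [tally]; the others below 32 are temporaries.  The status
   of v is at address 32 + v, the matrix entry (i, j) at 32 + n + i * n + j. *)
Definition copy (i j : nat) : cmd := Ins (Add i j 0).

Definition search_cmd : cmd :=
  copy 20 2 ;;
  For 20 (Ins (Const 21 32) ;; Ins (Add 21 21 20) ;; Ins (Fetch 22 21) ;;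
    Ite 22 (Ins (Sub 22 22 1) ;; Ite 22 Skip (Ins (Add 10 20 1))) Skip).

(** Without multiplication, the address of row v is reached by adding n to the matrix address v
    times (register 25). Register 24 holds v and register 26 the number of discoveries. *)
Definition expand_cmd : cmd :=
  Ins (Sub 24 10 1) ;; Ins (Const 21 32) ;; Ins (Add 21 21 24) ;;
  Ins (Const 22 3) ;; Ins (Store 21 22) ;;
  copy 25 9 ;; copy 20 24 ;; For 20 (Ins (Add 25 25 2)) ;;
  Ins (Const 26 0) ;; Ins (Const 10 0) ;; copy 20 2 ;;
  For 20 (Ins (Add 21 25 20) ;; Ins (Fetch 22 21) ;;
    Ite 22
      (Ins (Const 21 32) ;; Ins (Add 21 21 20) ;; Ins (Fetch 22 21) ;;
       Ite 22 Skip
         (Ins (Store 21 1) ;; Ins (Add 26 26 1) ;; Ins (Add 10 20 1)))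
      Skip) ;;
  Ins (Sub 22 26 1) ;; Ite 22 (Ins (Const 10 0)) Skip.

(** [search_cmd] leaves its result in register 10, where [expand_cmd] also expects a forced vertex.
    That register holds v.+1, hence the base 31 in place of 32. *)
Definition visit_cmd : cmd :=
  Ite 10 expand_cmd
    (search_cmd ;;
     Ite 10
       (Ins (Add 11 11 11) ;; Ins (Sub 20 12 11) ;;
        Ite 20
          (Ins (Const 21 31) ;; Ins (Add 21 21 10) ;; Ins (Const 22 2) ;;
           Ins (Store 21 22) ;; Ins (Const 10 0))
          (Ins (Sub 11 11 12) ;; expand_cmd))
       Skip).

Definition tally_cmd : cmd :=
  Ins (Const 14 0) ;; Ins (Const 15 0) ;; copy 20 2 ;;
  For 20 (Ins (Const 21 32) ;; Ins (Add 21 21 20) ;; Ins (Fetch 22 21) ;;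
    Ite 22
      (Ins (Const 23 3) ;; Ins (Sub 23 23 22) ;; Ite 23 (Ins (Add 15 15 1)) Skip)
      (Ins (Add 14 14 1))).

Definition explore_cmd : cmd :=
  copy 20 2 ;; Ins (Const 22 0) ;;
  For 20 (Ins (Const 21 32) ;; Ins (Add 21 21 20) ;; Ins (Store 21 22)) ;;
  Ins (Const 21 32) ;; Ins (Add 21 21 7) ;; Ins (Store 21 1) ;;
  Ins (Add 10 7 1) ;; copy 13 2 ;; For 13 visit_cmd ;; tally_cmd.

Definition frame (n b : nat) (r r' : nat -> nat) : Prop :=
  forall j, (j < b) || (32 + n <= j) -> r' j = r j.

Definition has_status (n : nat) (r st : nat -> nat) : Prop :=
  forall v, v < n -> r (32 + v) = st v.

Lemma upd_eq (r : nat -> nat) (i v j : nat) : j = i -> upd r i v j = v.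
Proof. by move=> ->; rewrite /upd eqxx. Qed.

Lemma upd_ne (r : nat -> nat) (i v j : nat) : j <> i -> upd r i v j = r j.
Proof. by move/eqP=> H; rewrite /upd (negPf H). Qed.

(** Whether two register addresses coincide is left to [lia]. *)
Ltac upds := cbn [effect fst snd]; repeat match goal with
  |- context [upd ?r ?i ?v ?j] =>
    first [ rewrite (@upd_eq r i v j); [|solve [reflexivity | lia]]
          | rewrite (@upd_ne r i v j); [|solve [lia]]] end.

Ltac exec1 := first [apply: wp_inseq | apply: wp_ins]; [by [] | lia | upds].

(** * Correctness and running time of the search commands *)

Section Commands.
Variables (n : nat) (adj : nat -> nat -> bool).
Implicit Types (r st : nat -> nat) (u : seq nat).

Lemma wp_search r0 st u : r0 0 = 0 -> r0 1 = 1 -> r0 2 = n -> r0 10 = 0 ->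
  has_status n r0 st ->
  wp search_cmd (n * 12 + 3) (fun r _ => r 10 = search n st /\
    forall j, (j < 20) && (j != 10) || (32 <= j) -> r j = r0 j) r0 u.
Proof.
move=> z0 z1 z2 z10 Hst; exec1.
pose S c r (_ : seq nat) := r 10 = c /\
   forall j, (j < 20) && (j != 10) || (32 <= j) -> r j = r0 j.
rewrite z0 z2 addn0; apply: (wp_weaken (T := n * (9 + 3) + 2)); [| lia | by move=> ? ? H; exact: H].
apply: (@wp_for _ (fun i c => if st i == 1 then i.+1 else c) S).
- by move=> a r u0 [_ F]; rewrite F.
- move=> a r u0 v [E F]; split; first by upds.
  by move=> j Hj; upds; apply: F.
- move=> i a r u0 ilt [E F] E20.
  have F1 : r 1 = 1 by rewrite F.
  have Fi : r (32 + i) = st i by rewrite F ?Hst //; lia.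
  exec1; exec1; rewrite E20; exec1; rewrite Fi.
  apply: wp_ite; [by upds | by move=> r' ? [[_ F'] _]; rewrite F' | lia | upds => pos | upds => z].
    exec1; rewrite F1.
    apply: wp_ite; [by upds | by move=> r' ? [[_ F'] _]; rewrite F' | lia | upds => ne | upds => z].
      apply: wp_skip; rewrite ifN; last lia.
      by split; [split|]; [upds | move=> j Hj; upds; apply: F | upds].
    exec1; rewrite E20 F1 (_ : (st i == 1) = true); last lia.
    by split; [split|]; [upds; lia | move=> j Hj; upds; apply: F | upds].
  apply: wp_skip; rewrite ifN; last lia.
  by split; [split|]; [upds | move=> j Hj; upds; apply: F | upds].
- by split; [upds | move=> j Hj; upds].
- by upds.
Qed.


Lemma downto_addn m a d : downto (fun _ b => b + d) m a = a + m * d.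
Proof. by elim: m a => [|m IH] a //=; rewrite ?IH ?mulSn; lia. Qed.

Lemma wp_expand r0 st v u : r0 0 = 0 -> r0 1 = 1 -> r0 2 = n -> r0 9 = 32 + n ->
  (forall i j, i < n -> j < n -> r0 (32 + n + i * n + j) = adj i j) ->
  has_status n r0 st -> r0 10 = v.+1 -> v < n ->
  wp expand_cmd (n * 24 + 20) (fun r _ =>
    [/\ has_status n r (expand n adj st v).1, r 10 = (expand n adj st v).2,
        (expand n adj st v).2 <= n
      & forall j, (j < 20) && (j != 10) || (32 + n <= j) -> r j = r0 j]) r0 u.
Proof.
move=> z0 z1 z2 z9 Hadj Hst z10 vn.
exec1; rewrite z10 z1 subn1 /=.
do 6!exec1; rewrite z0 z9 !addn0.
set r1 := upd _ 20 _.
apply: (wp_seq (T1 := n * (1 + 3) + 2) (Q1 := fun r _ => r 25 = 32 + n + v * n /\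
  forall j, (j < 20) || (32 <= j) -> r j = r1 j)).
- apply: (wp_weaken (T := v * (1 + 3) + 2)); last first.
  + move=> r u'; rewrite -(downto_addn v (32 + n)) => H; exact: H.
  + nia.
  + apply: (@wp_for _ (fun _ b => b + n)
      (fun a r _ => r 25 = a /\ forall j, (j < 20) || (32 <= j) -> r j = r1 j)).
    * by move=> a r u0 [_ F]; rewrite F //; rewrite /r1; upds.
    * move=> a r u0 w [E F]; split; first by upds.
      by move=> j Hj; upds; apply: F.
    * move=> i a r u0 ilt [E F] E20; exec1.
      rewrite E F //; split; last by upds.
      split; last by move=> j Hj; upds; apply: F.
      by upds; rewrite /r1; upds; rewrite z2.
    * by rewrite /r1; split; [upds | move=> j Hj; upds].
    * by rewrite /r1; upds.
- lia.
move=> r2 u2 [E25 F2].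
have G j : (j < 20) || (32 + n <= j) -> r2 j = r0 j.
  by move=> Hj; rewrite F2; [rewrite /r1; upds | lia].
have H2 : has_status n r2 (upd st v 3).
  move=> w wn; rewrite F2; last lia.
  rewrite /r1; upds; case: (eqVneq w v) => [->|wv]; first by upds.
  by upds; apply: Hst.
do 3!exec1; rewrite !G // z0 z2 addn0.
pose S (s : (nat -> nat) * nat * nat) r (_ : seq nat) :=
  [/\ has_status n r s.1.1, r 26 = s.1.2, r 10 = s.2, s.2 <= n &
    r 25 = 32 + n + v * n /\
    forall j, (j < 20) && (j != 10) || (32 + n <= j) -> r j = r0 j].
apply: (wp_seq (T1 := n * (13 + 3) + 2)
  (Q1 := S (downto (discover adj v) n (upd st v 3, 0, 0)))); last first.
- rewrite /expand; case: (downto _ _ _) => [[st' c] l] r u3 [/= K1 K2 K3 K4 [_ K5]].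
  exec1; rewrite K2 K5 // z1.
  apply: wp_ite; [by upds; rewrite K5 | by move=> r' ? [_ _ _ ->] | lia | upds => p | upds => z].
    exec1; rewrite leqNgt (_ : 1 < c); last lia.
    split; [|by upds|by []|].
      by move=> w wn; upds; apply: K1.
    by move=> j Hj; upds; apply: K5.
  apply: wp_skip; rewrite (_ : c <= 1); last lia.
  split; [|by upds|by []|].
    by move=> w wn; upds; apply: K1.
  by move=> j Hj; upds; apply: K5.
- lia.
apply: (wp_weaken (T := n * (13 + 3) + 2)); [|lia|by move=> r u' H; exact: H].
apply: (@wp_for _ (discover adj v) S).
- by move=> a r u0 [_ _ _ _ [_ ->]].
- move=> a r u0 w [K1 K2 K3 K4 [K5 K6]]; split; [|by upds|by upds|by []|split; first by upds].
    by move=> x xn; upds; apply: K1.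
  by move=> j Hj; upds; apply: K6.
- move=> w [[st' c] l] r u0 wn [/= K1 K2 K3 K4 [K5 K6]] E20.
  have r1' : r 1 = 1 by rewrite K6.
  exec1; rewrite E20 K5; exec1.
  rewrite K6; last by lia.
  rewrite Hadj //.
  apply: wp_ite; [by upds | by move=> r' ? [[_ _ _ _ [_ F']] _]; rewrite F' | lia | upds | upds].
    case: (adj v w) => //= _.
    exec1; exec1; rewrite E20; exec1; rewrite K1 //.
    apply: wp_ite; [by upds | by move=> r' ? [[_ _ _ _ [_ F']] _]; rewrite F' | lia | upds => p | upds => z].
      apply: wp_skip; rewrite ifN; last lia.
      split; last by upds.
      split; [|by upds|by upds|by []|split; first by upds].
        by move=> x xn; upds; apply: K1.
      by move=> j Hj; upds; apply: K6.
    rewrite z eqxx; do 3!exec1; rewrite r1' K2 E20 !addn1.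
    split; last by upds.
    split; [|by upds|by upds|by []|split; first by upds].
      move=> x xn; case: (eqVneq x w) => [->|xw]; first by upds.
      by upds; apply: K1.
    by move=> j Hj; upds; apply: K6.
  case: (adj v w) => //= _.
  apply: wp_skip; split; last by upds.
  split; [|by upds|by upds|by []|split; first by upds].
    by move=> x xn; upds; apply: K1.
  by move=> j Hj; upds; apply: K6.
- split; [|by upds|by upds|by []|split; first by upds].
    by move=> x xn; upds; apply: H2.
  by move=> j Hj; upds; apply: G; lia.
- by upds.
Qed.


Lemma searchP st : (search n st = 0 /\ forall v, v < n -> st v <> 1) \/
  exists v, [/\ search n st = v.+1, v < n & st v = 1].
Proof.
suff: forall m c, let d := downto (fun i c => if st i == 1 then i.+1 else c) m c in
    (d = c /\ forall v, v < m -> st v <> 1) \/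
    exists v, [/\ d = v.+1, v < m & st v = 1] by move=> /(_ n 0).
elim=> [|m IH] c /=; first by left.
case: (IH (if st m == 1 then m.+1 else c)) => [[-> H]|[v [-> vm E]]]; last first.
  by right; exists v; split=> //; apply: ltnW.
case: eqP => E; first by right; exists m.
by left; split=> // v; rewrite ltnS leq_eqVlt => /predU1P [->|/H].
Qed.

Definition env r := [/\ r 0 = 0, r 1 = 1, r 2 = n, r 9 = 32 + n &
  forall i j, i < n -> j < n -> r (32 + n + i * n + j) = adj i j].

Lemma env_frame r r' : env r -> frame n 10 r r' -> env r'.
Proof.
move=> [z0 z1 z2 z9 Ha] F; split; rewrite ?F //.
by move=> i j ilt jlt; rewrite F ?Ha //; lia.
Qed.

(** The bound [s.1.2 <= n] ensures that a positive [cur] names a vertex. *)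
Definition in_state M s r := [/\ has_status n r s.1.1, r 10 = s.1.2, s.1.2 <= n,
  r 11 = s.2 & r 12 = M].

Lemma wp_visit M s r0 u : env r0 -> in_state M s r0 ->
  wp visit_cmd (n * 36 + 40) (fun r _ => in_state M (visit n adj M s) r /\
    forall j, (j < 20) && (j != 10) && (j != 11) || (32 + n <= j) -> r j = r0 j)
    r0 u.
Proof.
move=> [z0 z1 z2 z9 Ha]; case: s => [[st cur] h] [/= Hst z10 curn z11 z12].
apply: wp_ite; [by [] | by move=> r' ? [_ F']; rewrite F' | lia | |];
  rewrite z10 => Hcur.
  rewrite Hcur; case: cur Hcur z10 curn => // v _ z10 vn.
  apply: (wp_weaken (wp_expand u z0 z1 z2 z9 Ha Hst z10 vn)); first lia.
  move=> r u' [K1 K2 K3 K4]; split; last by move=> j Hj; apply: K4; lia.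
  by split=> //=; rewrite ?K4.
rewrite Hcur /=; rewrite Hcur in z10.
apply: (wp_seq (wp_search u z0 z1 z2 z10 Hst)); first lia.
move=> r1 u1 [E10 F1].
have r1st : has_status n r1 st by move=> v vn; rewrite F1 ?Hst //; lia.
apply: wp_ite; [by rewrite F1 | by move=> r' ? [_ F']; rewrite F' | lia | |];
  case: (searchP st) => [[E H]|[v [E vn Ev]]]; rewrite E10 E // => _; last first.
  apply: wp_skip; split; last by move=> j Hj; apply: F1; lia.
  by split=> /=; [| rewrite E10 | | rewrite F1 | rewrite F1].
exec1; rewrite F1 // z11; exec1; rewrite F1 // z12.
apply: wp_ite; [by upds; rewrite F1 | by move=> r' ? [_ F']; rewrite F' | lia | upds => p | upds => z].
  rewrite leqNgt (_ : h + h < M); last lia.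
  rewrite /=; do 5!exec1; rewrite E10 E.
  have ad : 31 + v.+1 = 32 + v by lia.
  split.
    split=> /=; [|by upds|by []|by upds|by upds; rewrite F1].
    move=> w wn; case: (eqVneq w v) => [->|wv]; first by upds.
    by upds; apply: r1st.
  by move=> j Hj; upds; apply: F1; lia.
rewrite (_ : M <= h + h); last lia.
exec1; rewrite F1 // z12.
set r2 := upd _ 11 _.
have G j : (j < 20) && (j != 10) && (j != 11) || (32 <= j) -> r2 j = r0 j.
  by move=> Hj; rewrite /r2; upds; apply: F1; lia.
have Hst2 : has_status n r2 st by move=> w wn; rewrite G ?Hst //; lia.
have Ha2 i j : i < n -> j < n -> r2 (32 + n + i * n + j) = adj i j.
  by move=> ilt jlt; rewrite G ?Ha //; lia.
have y10 : r2 10 = v.+1 by rewrite /r2; upds; rewrite E10.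
have y0 : r2 0 = 0 by rewrite G.
have y1 : r2 1 = 1 by rewrite G.
have y2 : r2 2 = n by rewrite G.
have y9 : r2 9 = 32 + n by rewrite G.
apply: (wp_weaken (wp_expand u1 y0 y1 y2 y9 Ha2 Hst2 y10 vn)); first lia.
move=> r u' [K1 K2 K3 K4]; split; last by move=> j Hj; rewrite K4 ?G //; lia.
by split=> //=; rewrite ?K4 // /r2; upds; rewrite // F1.
Qed.

Lemma wp_tally st r0 u : r0 0 = 0 -> r0 1 = 1 -> r0 2 = n -> has_status n r0 st ->
  wp tally_cmd (n * 13 + 5) (fun r _ =>
    [/\ r 14 = (tally n st).1, r 15 = (tally n st).2 & frame n 10 r0 r]) r0 u.
Proof.
move=> z0 z1 z2 Hst; do 3!exec1; rewrite z0 z2 addn0.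
pose S (c : nat * nat) r (_ : seq nat) := [/\ r 14 = c.1, r 15 = c.2 &
  forall j, (j < 14) || (32 <= j) -> r j = r0 j].
apply: (wp_weaken (T := n * (10 + 3) + 2)); [|lia|]; last first.
  by move=> r u' H; case: (H : S (tally n st) r u') => A B C; split=> // j Hj; apply: C; lia.
apply: (@wp_for _ _ S).
- by move=> a r u0 [_ _ ->].
- move=> a r u0 w [K1 K2 K3]; split; [by upds | by upds |].
  by move=> j Hj; upds; apply: K3.
- move=> i [a b] r u0 ilt [/= K1 K2 K3] E20.
  have F1 : r 1 = 1 by rewrite K3.
  have Fi : r (32 + i) = st i by rewrite K3 ?Hst //; lia.
  exec1; exec1; rewrite E20; exec1; rewrite Fi.
  apply: wp_ite; [by upds | by move=> r' ? [[_ _ F'] _]; rewrite F' | lia | upds => p | upds => z].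
    exec1; exec1.
    apply: wp_ite; [by upds | by move=> r' ? [[_ _ F'] _]; rewrite F' | lia | upds => q | upds => z].
      exec1; rewrite K2 F1; split; last by upds.
      split; [by upds; rewrite K1; lia | by upds; rewrite /=; lia |].
      by move=> j Hj; upds; apply: K3.
    apply: wp_skip; split; last by upds.
    split; [by upds; rewrite K1 /=; lia | by upds; rewrite K2 /=; lia |].
    by move=> j Hj; upds; apply: K3.
  exec1; rewrite K1 F1; split; last by upds.
  split; [by upds; rewrite /=; lia | by upds; rewrite K2 /=; lia |].
  by move=> j Hj; upds; apply: K3.
- by split; [upds | upds | move=> j Hj; upds].
- by upds.
Qed.

Lemma downto_clear m st v :
  (v < m) || (st v == 0) -> downto (fun i st => upd st i 0) m st v = 0.
Proof.
elim: m st => [|m IH] st /= H; first by apply/eqP.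
by apply: IH; rewrite /upd; case: (eqVneq v m) => vm; lia.
Qed.

Definition explore_time : nat := n * (n * 36 + 80) + 40.

Lemma wp_explore M h r0 u : env r0 -> r0 7 < n -> r0 11 = h -> r0 12 = M ->
  wp explore_cmd explore_time (fun r _ =>
    let c := tally n (explore n adj M (r0 7) h) in
    [/\ r 14 = c.1, r 15 = c.2 & frame n 10 r0 r]) r0 u.
Proof.
move=> E0; case: (E0) => z0 z1 z2 z9 Ha z7 z11 z12; rewrite /explore_time.
exec1; exec1; rewrite z0 z2 addn0.
set r1 := upd _ _ _.
apply: (wp_seq (T1 := n * (3 + 3) + 2) (Q1 := fun r _ =>
  (forall v, v < n -> r (32 + v) = 0) /\
  forall j, (j < 20) || (32 + n <= j) -> r j = r0 j)).
- pose S st r (_ : seq nat) := [/\ r 22 = 0, has_status n r st &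
    forall j, (j < 20) || (32 + n <= j) -> r j = r0 j].
  apply: (wp_weaken (@wp_for _ (fun i st => upd st i 0) S 20 _ 3 n
    (fun v => r0 (32 + v)) _ _ _ _ _ _ _)); last first.
  + by move=> r u' [_ A B]; split=> // v vn; rewrite A ?downto_clear ?vn.
  + lia.
  + by rewrite /r1; upds.
  + by rewrite /r1; split; [upds | move=> v vn; upds | move=> j Hj; upds].
  + move=> i st r u0 ilt [y22 A B] E20.
    exec1; exec1; rewrite E20; exec1; rewrite y22.
    split; last by upds.
    split; [by upds | | by move=> j Hj; upds; apply: B].
    move=> v Hv; case: (eqVneq v i) => [->|vi]; first by upds.
    by upds; apply: A.
  + move=> st r u0 v [y22 A B]; split; [by upds | | by move=> j Hj; upds; apply: B].
    by move=> w Hw; upds; apply: A.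
  + by move=> st r u0 [_ _ ->].
- lia.
move=> r2 u2 [C F]; exec1; exec1; rewrite F //; exec1; rewrite F // z1.
exec1; rewrite !F // z1; exec1; rewrite !F // z0 z2 addn0 addn1.
set r3 := upd _ 13 _.
have F3 : frame n 10 r0 r3 by move=> j Hj; rewrite /r3; upds; apply: F; lia.
have I3 : in_state M (start (r0 7) h) r3.
  rewrite /r3; split=> /=; [|by upds|by []|by upds; rewrite F|by upds; rewrite F].
  move=> v vn; case: (eqVneq v (r0 7)) => [->|vr]; first by upds.
  by upds; apply: C.
apply: (wp_seq (T1 := n * (n * 36 + 40 + 3) + 2) (Q1 := fun r _ =>
  in_state M (downto (fun _ => visit n adj M) n (start (r0 7) h)) r /\ frame n 10 r0 r)).
- apply: (@wp_for _ (fun _ => visit n adj M) (fun s r _ => in_state M s r /\ frame n 10 r0 r)).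
  + by move=> a r u0 [_ ->].
  + move=> a r u0 v [[K1 K2 K3 K4 K5] K6]; split; last by move=> j Hj; upds; apply: K6.
    split; [by move=> w wn; upds; apply: K1 | by upds | by [] | by upds | by upds].
  + move=> i s r u0 ilt [K1 K2] E13.
    apply: (wp_weaken (wp_visit u0 (env_frame E0 K2) K1)) => //.
    move=> r' u' [L1 L2]; split; last by rewrite L2.
    by split=> // j Hj; rewrite L2 ?K2 //; lia.
  + by split.
  + by rewrite /r3; upds.
- nia.
move=> r4 u4 [[K1 K2 K3 K4 K5] K6]; have [y0 y1 y2 y9 Ha4] := env_frame E0 K6.
apply: (wp_weaken (wp_tally u4 y0 y1 y2 K1)); first nia.
by move=> r u' [A B G]; split=> // j Hj; rewrite G ?K6.
Qed.

End Commands.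

(** * Reading the input and looping over roots and guesses *)

Definition init_cmd : cmd :=
  Ins (Const 1 1) ;; Ins (Read 2) ;; Ins (Read 3) ;;
  Ins (Const 9 32) ;; Ins (Add 9 9 2) ;;
  copy 20 2 ;; For 20 (Ins (Add 21 21 2)) ;; copy 22 9 ;;
  For 21 (Ins (Read 23) ;; Ins (Store 22 23) ;; Ins (Add 22 22 1)) ;;
  Ins (Const 4 1) ;; copy 20 3 ;; For 20 (Ins (Add 4 4 4) ;; Ins (Add 4 4 4)) ;;
  Ins (Const 6 2) ;; Ins (Sub 6 6 3).

Definition guess_cmd : cmd :=
  copy 11 8 ;; copy 12 4 ;; explore_cmd ;; Ins (Sub 20 3 15) ;;
  Ite 20 Skip (Ins (Const 6 1)).

(** The first exploration has M = 0, so it expands every vertex it finds: it is plain graph search,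
    and register 14 counts the vertices that the root does not reach. *)
Definition root_cmd : cmd :=
  Ins (Const 11 0) ;; Ins (Const 12 0) ;; explore_cmd ;;
  Ite 14 Skip (Ins (Const 5 1)) ;; copy 8 4 ;; For 8 guess_cmd.

Definition main_cmd : cmd :=
  init_cmd ;; copy 7 2 ;; For 7 root_cmd ;; Ite 5 (copy 0 6) Skip.

Lemma downto_has (t : nat -> bool) m b :
  downto (fun i c => c || t i) m b = b || has t (iota 0 m).
Proof.
elim: m b => [|m IH] b; first by rewrite /= orbF.
rewrite [downto _ _ _]/= IH -[m.+1]addn1 iotaD has_cat /= add0n orbF.
by rewrite -orbA [t m || _]orbC.
Qed.

Lemma downto_quadruple m b : downto (fun _ c => c + c + (c + c)) m b = 4 ^ m * b.
Proof.
elim: m b => [|m IH] b /=; first by rewrite mul1n.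
by rewrite IH expnSr -mulnA; congr muln; lia.
Qed.

Section Main.
Variables (n k : nat) (adj : nat -> nat -> bool).

Definition reaches_all v : bool := (tally n (explore n adj 0 v 0)).1 == 0.

Definition wins v h : bool := k <= (tally n (explore n adj (4 ^ k) v h)).2.

Definition answer : bool :=
  has reaches_all (iota 0 n) &&
  ((k <= 1) || has (fun v => has (wins v) (iota 0 (4 ^ k))) (iota 0 n)).

Implicit Types (r : nat -> nat) (u : seq nat).

Lemma env_upd r i v : 2 < i < 32 -> i != 9 -> env n adj r -> env n adj (upd r i v).
Proof.
move=> Hi i9 [z0 z1 z2 z9 Ha]; split; [by upds | by upds | by upds | by upds |].
by move=> a b an bn; upds; apply: Ha.
Qed.

Lemma wp_init u : 0 < k -> size u = n * n ->
  (forall i j, i < n -> j < n -> nth 0 u (i * n + j) = adj i j) ->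
  wp init_cmd (n * n * 6 + n * 4 + k * 5 + 20) (fun r _ =>
    [/\ env n adj r, r 3 = k, r 4 = 4 ^ k, r 5 = 0 & r 6 = (k <= 1)])
    (fun=> 0) [:: n, k & u].
Proof.
move=> k0 su Hu; do 6!exec1; rewrite [head _ _]/= [behead _]/= [head _ _]/= [behead _]/= !addn0.
set r1 := upd _ 20 _.
have z0 : r1 0 = 0 by rewrite /r1; upds.
have z1 : r1 1 = 1 by rewrite /r1; upds.
have z2 : r1 2 = n by rewrite /r1; upds.
have z3 : r1 3 = k by rewrite /r1; upds.
have z5 : r1 5 = 0 by rewrite /r1; upds.
have z9 : r1 9 = 32 + n by rewrite /r1; upds.
have z20 : r1 20 = n by rewrite /r1; upds.
have z21 : r1 21 = 0 by rewrite /r1; upds.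
apply: (wp_seq (T1 := n * (1 + 3) + 2) (Q1 := fun r u' => [/\ r 21 = n * n, u' = u &
  forall j, j < 20 -> r j = r1 j])).
- apply: (wp_weaken (T := n * (1 + 3) + 2)); last first.
  + by move=> r u'; rewrite -[n * n]add0n -(downto_addn n 0) => H; exact: H.
  + lia.
  + apply: (@wp_for _ (fun _ b => b + n) (fun a r u' =>
      [/\ r 21 = a, u' = u & forall j, j < 20 -> r j = r1 j])) => //.
    * by move=> a r u0 [_ _ ->].
    * move=> a r u0 v [E Eu F]; split; [by upds | by [] |].
      by move=> j Hj; upds; apply: F.
    * move=> i a r u0 ilt [E Eu F] E20; exec1; rewrite E F // z2.
      split; last by upds.
      by split; [upds | | move=> j Hj; upds; apply: F].
- lia.
move=> r2 u2 [E21 -> F2]; exec1; rewrite !F2 // z0 z9 addn0.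
apply: (wp_seq (T1 := n * n * (3 + 3) + 2) (Q1 := fun r _ =>
  (forall t, t < n * n -> r (32 + n + t) = nth 0 u t) /\
  forall j, j < 20 -> r j = r1 j)).
(* The abstract state is the number of entries read so far; it increases while the loop counter
   decreases, so the matrix is stored in reading order. *)
- apply: (wp_weaken (T := n * n * (3 + 3) + 2)); [|lia|]; last first.
  + move=> r u' H; case: (H : (fun a r u' => [/\ r 22 = 32 + n + a, u' = drop a u,
      (forall t, t < a -> r (32 + n + t) = nth 0 u t) &
      forall j, j < 20 -> r j = r1 j]) (downto (fun _ b => b + 1) (n * n) 0) r u').
    by rewrite downto_addn muln1 add0n.
  + apply: (@wp_for _ (fun _ b => b + 1) (fun a r u' =>
      [/\ r 22 = 32 + n + a, u' = drop a u,
      (forall t, t < a -> r (32 + n + t) = nth 0 u t) &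
      forall j, j < 20 -> r j = r1 j])).
    * by move=> a r u0 [_ _ _ ->].
    * move=> a r u0 v [A B C F]; split; [by upds | by [] | |].
        by move=> t ta; upds; apply: C.
      by move=> j Hj; upds; apply: F.
    * move=> i a r u0 ilt [A -> C F] E20; do 3!exec1; rewrite A F // z1.
      split; last by upds.
      split; [by upds; lia | by rewrite -drop1 drop_drop add1n addn1 | |].
        move=> t; rewrite addn1 ltnS leq_eqVlt; case: eqP => /= [-> _|ta tlt].
          by upds; rewrite -nth0 nth_drop addn0.
        by upds; apply: C.
      by move=> j Hj; upds; apply: F.
    * split; [by upds; lia | by rewrite drop0 | by [] |].
      by move=> j Hj; upds; apply: F2.
    * by upds.
- lia.
move=> r3 u3 [C3 F3]; exec1; exec1; rewrite !F3 // z0 z3 addn0.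
apply: (wp_seq (T1 := k * (2 + 3) + 2) (Q1 := fun r _ => r 4 = 4 ^ k /\
  forall j, (j < 20) && (j != 4) || (32 <= j) -> r j = r3 j)).
- apply: (wp_weaken (T := k * (2 + 3) + 2)); [|lia|]; last first.
  + by move=> r u'; rewrite -[4 ^ k]muln1 -downto_quadruple => H; exact: H.
  + apply: (@wp_for _ (fun _ b => b + b + (b + b)) (fun a r _ => r 4 = a /\
      forall j, (j < 20) && (j != 4) || (32 <= j) -> r j = r3 j)).
    * by move=> a r u0 [_ ->] //; rewrite F3.
    * move=> a r u0 v [A F]; split; first by upds.
      by move=> j Hj; upds; apply: F.
    * move=> i a r u0 ilt [A F] E20; do 2!exec1; rewrite A.
      split; last by upds.
      split; first by upds; lia.
      by move=> j Hj; upds; apply: F.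
    * by split; [upds | move=> j Hj; upds].
    * by upds.
- lia.
move=> r4 u4 [E4 F4]; do 2!exec1; rewrite F4 // F3 // z3.
(* Register 6 holds [2 - k], which is the truth value of [k <= 1] because [k] is positive. *)
split; [|by []|by []|by rewrite F4 // F3|lia].
apply: env_upd => //; apply: env_upd => //.
split; [by rewrite F4 // F3 | by rewrite F4 // F3 | by rewrite F4 // F3 | by rewrite F4 // F3 |].
move=> i j ilt jlt; rewrite F4; last lia.
by rewrite -addnA C3 ?Hu //; nia.
Qed.

Definition in_main (a : bool * bool) r : Prop :=
  [/\ env n adj r, r 3 = k, r 4 = 4 ^ k, r 5 = a.1 & r 6 = a.2].

Lemma wp_guess v a b r u h : v < n -> in_main (a, b) r -> r 7 = v -> r 8 = h ->
  wp guess_cmd (explore_time n + 6) (fun r' _ =>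
    [/\ in_main (a, b || wins v h) r', r' 7 = v & r' 8 = h]) r u.
Proof.
move=> vn [He z3 z4 /= z5 z6] z7 z8; case: (He) => z0 _ _ _ _.
exec1; exec1; rewrite z8 z4 z0 !addn0; set r1 := upd _ _ _.
have He1 : env n adj r1 by do 2!apply: env_upd => //.
have y7 : r1 7 < n by rewrite /r1; upds; rewrite z7.
apply: (wp_seq (wp_explore (M := 4 ^ k) (h := h) u He1 y7 _ _));
  [by rewrite /r1; upds | by rewrite /r1; upds | lia |].
move=> r2 u2 [_ E15 F2]; have He2 := env_frame He1 F2.
have {}F2 j : j < 10 -> r2 j = r j by move=> Hj; rewrite F2 ?Hj // /r1; upds.
rewrite (_ : r1 7 = v) in E15; last by rewrite /r1; upds.
have [_ y1 _ _ _] := He2.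
exec1; rewrite E15 F2 // z3.
apply: wp_ite; [by upds | by move=> r' ? [[[_ ->]]] | lia | upds => p | upds => z].
  rewrite (_ : wins v h = false) ?orbF; last by rewrite /wins; lia.
  apply: wp_skip; split; [|by upds; rewrite F2|by upds; rewrite F2].
  split; [exact: env_upd|by upds; rewrite F2|by upds; rewrite F2|by upds; rewrite F2|by upds; rewrite F2].
rewrite (_ : wins v h); last by rewrite /wins; lia.
rewrite orbT; exec1; split; [|by upds; rewrite F2|by upds; rewrite F2].
split; [by do 2!apply: env_upd => //|by upds; rewrite F2|by upds; rewrite F2|by upds; rewrite F2|by upds].
Qed.

Lemma wp_root v a r u : v < n -> in_main a r -> r 7 = v ->
  wp root_cmd (4 ^ k * (explore_time n + 9) + (explore_time n + 8)) (fun r' _ =>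
    in_main (a.1 || reaches_all v, a.2 || has (wins v) (iota 0 (4 ^ k))) r' /\
    r' 7 = v) r u.
Proof.
case: a => a b vn [He z3 z4 /= z5 z6] z7; case: (He) => z0 _ _ _ _.
exec1; exec1; set r1 := upd _ _ _.
have He1 : env n adj r1 by do 2!apply: env_upd => //.
have y7 : r1 7 < n by rewrite /r1; upds; rewrite z7.
apply: (wp_seq (wp_explore (M := 0) (h := 0) u He1 y7 _ _));
  [by rewrite /r1; upds | by rewrite /r1; upds | lia |].
move=> r2 u2 [E14 _ F2]; have He2 := env_frame He1 F2.
have {}F2 j : j < 10 -> r2 j = r j by move=> Hj; rewrite F2 ?Hj // /r1; upds.
rewrite (_ : r1 7 = v) in E14; last by rewrite /r1; upds.
have [_ y1 _ _ _] := He2.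
apply: (wp_seq (T1 := 3) (Q1 := fun r _ => in_main (a || reaches_all v, b) r /\ r 7 = v)).
- apply: wp_ite; [by [] | by move=> r' ? [[[_ ->]]] | lia | rewrite E14 => p | rewrite E14 => z].
    apply: wp_skip; split; last by rewrite F2.
    rewrite (_ : reaches_all v = false) ?orbF; last by rewrite /reaches_all; lia.
    by split; rewrite ?F2.
  exec1; split; last by upds; rewrite F2.
  rewrite (_ : reaches_all v); last by rewrite /reaches_all; lia.
  rewrite orbT; split; [exact: env_upd|by upds; rewrite F2|by upds; rewrite F2|by upds|by upds; rewrite F2].
- lia.
move=> r3 u3 [[He3 x3 x4 /= x5 x6] x7]; have [x0 _ _ _ _] := He3.
exec1; rewrite x0 x4 addn0.
apply: (wp_weaken (T := 4 ^ k * (explore_time n + 6 + 3) + 2)); [|lia|]; last first.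
  by move=> r4 u4; rewrite -(downto_has (wins v) (4 ^ k) b) => H; exact: H.
apply: (@wp_for _ (fun i c => c || wins v i)
  (fun c r _ => in_main (a || reaches_all v, c) r /\ r 7 = v)).
- by move=> c r' u' [[[]]].
- move=> c r' u' w [[A B C D F] G]; split; last by upds.
  by split; [exact: env_upd | upds | upds | upds | upds].
- move=> i c r' u' ilt [A B] C; apply: (wp_weaken (wp_guess u' vn A B C)) => //.
  by move=> r4 u4 [].
- by split; [split; [exact: env_upd | upds | upds | upds | upds] | upds].
- by upds.
Qed.

Definition main_time : nat :=
  n * n * 6 + n * 4 + k * 5 + 20 +
  (n * (4 ^ k * (explore_time n + 9) + (explore_time n + 8) + 3) + 6).

Lemma wp_main u : 0 < k -> size u = n * n ->
  (forall i j, i < n -> j < n -> nth 0 u (i * n + j) = adj i j) ->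
  wp main_cmd main_time (fun r _ => r 0 = answer) (fun=> 0) [:: n, k & u].
Proof.
move=> k0 su Hu; rewrite /main_time.
apply: (wp_seq (wp_init k0 su Hu)); first lia.
move=> r1 u1 [He z3 z4 z5 z6]; have [z0 z1 z2 z9 Ha] := He.
exec1; rewrite z0 z2 addn0.
set d := 4 ^ k * _ + _.
apply: (wp_seq (T1 := n * (d + 3) + 2) (Q1 := fun r _ => in_main
  (downto (fun v a => (a.1 || reaches_all v, a.2 || has (wins v) (iota 0 (4 ^ k))))
     n (false, k <= 1)) r)).
- apply: (@wp_for _ (fun v a => (a.1 || reaches_all v, a.2 || has (wins v) (iota 0 (4 ^ k))))
    (fun a r _ => in_main a r)).
  + by move=> a r u0 [[]].
  + move=> a r u0 w [A B C D F].
    by split; [exact: env_upd | upds | upds | upds | upds].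
  + by move=> i a r u0 ilt A B; apply: wp_root.
  + by split; [exact: env_upd | upds | upds | upds | upds].
  + by upds.
- lia.
have -> : downto (fun v a => (a.1 || reaches_all v, a.2 || has (wins v) (iota 0 (4 ^ k))))
     n (false, k <= 1) = (has reaches_all (iota 0 n), (k <= 1) ||
       has (fun v => has (wins v) (iota 0 (4 ^ k))) (iota 0 n)).
  rewrite -[has reaches_all _]orFb -!downto_has.
  by elim: (n) false (k <= 1) => [|m IH] a b //=; rewrite IH.
rewrite /answer => r2 u2 [[y0 y1 y2 _ _] _ _ /= y5 y6].
(* The conjunct on register 1 is what [wp_ite] demands of a postcondition. *)
apply: (wp_weaken (Q := fun r _ => r 0 = answer /\ r 1 = 1) (T := 3)); [|lia|by move=> r u' []].
apply: wp_ite => //; [by move=> r u' [] | rewrite y5 | rewrite y5]; rewrite /answer.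
  case: (has reaches_all _) => //= _; exec1; split; last by upds.
  by upds; rewrite y6 y0 addn0.
case: (has reaches_all _) => //= _; exact: wp_skip.
Qed.

End Main.

(** * Out-trees and internal sets *)

(** Positivity of [k] rules out the empty range, whose maximum is 0. *)
Lemma leq_bigmax_ex (I : finType) (P : pred I) (F : I -> nat) k :
  0 < k -> k <= \max_(i | P i) F i -> exists2 i, P i & k <= F i.
Proof.
move=> k0 H; case: (pickP (fun i => P i && (k <= F i))) => [i /andP []|no].
  by exists i.
suff : \max_(i | P i) F i <= k.-1 by lia.
by apply/bigmax_leqP=> i Pi; have := no i; rewrite Pi /=; lia.
Qed.

Section OutTreeTheory.
Variable V : finType.
Implicit Types (D : digraph V) (T : graph_data V) (I : {set V}) (r v w x y : V).

(* A set closed under f contains an f-cycle. *)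
Lemma acyclic_no_successor T (S : {set V}) (f : V -> V) :
  acyclic T -> (forall x, x \in S -> f x \in S) ->
  (forall x, x \in S -> underlying T x (f x)) ->
  (forall x, x \in S -> f x <> x) -> (forall x, x \in S -> f (f x) <> x) ->
  S = set0.
Proof.
move=> acT Sf Se f1 f2; apply/eqP; apply/negPn/negP => /set0Pn [x0 x0S].
(* A point with a smallest orbit lies on a cycle: the orbit of [f y] is contained in that of [y] and
   is not smaller, so it contains [y]. *)
have [y yS ymin] := arg_minnP (fun y => #|fconnect f y|) x0S.
have sub : fconnect f (f y) \subset fconnect f y.
  by apply/subsetP=> z; rewrite !inE; apply: connect_trans; apply: fconnect1.
have yfy : fconnect f (f y) y.
  have /subset_cardP E : #|fconnect f (f y)| = #|fconnect f y|.
    by apply/eqP; rewrite eqn_leq subset_leq_card //=; apply: ymin; apply: Sf.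
  by have := E sub y; rewrite !inE connect0.
have [p0 p0P p0l] := connectP yfy; case/shortenP: p0P p0l => p pP up _ pl.
have pathS q x : x \in S -> fpath f x q -> path (underlying T) x q /\ last x q \in S.
  elim: q x => [|z q IH] x xS //= /andP [/eqP <- qP].
  by have [A B] := IH _ (Sf _ xS) qP; rewrite A Se.
have [pT _] := pathS _ _ (Sf _ yS) pP.
have szc : size (f y :: p) < #|V|.+1 by rewrite ltnS -(card_uniqP up) max_card.
have := forallP (forallP acT (Ordinal szc)) (in_tuple (f y :: p)).
rewrite /= /ucycleb /= rcons_path pT -pl Se //= => /implyP /(_ up).
(* Acyclicity leaves only cycles of size 1 and 2, which the last two hypotheses on [f] exclude. *)
case: p {szc up pT} pP pl => [|z [|//]] /= => [_ /esym/(f1 _ yS)|] //.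
by move=> /andP [/eqP <- _] /esym /(f2 _ yS).
Qed.


Definition tree_arc T : rel V := fun x y => (x, y) \in T.2.

Lemma orientedP T x y : oriented T -> (x, y) \in T.2 -> (y, x) \notin T.2.
Proof. by move=> /forall_inP oT /oT. Qed.

Lemma subdigraphP D T x y : subdigraph D T -> (x, y) \in T.2 ->
  [/\ D x y, x \in T.1 & y \in T.1].
Proof. by move=> /forall_inP sT /sT /and3P. Qed.

(** A vertex not reached from the root has an in-neighbour, because only the root has none, and that
    in-neighbour is not reached either. The predecessor map on these vertices would run into a
    cycle. *)
Lemma out_tree_root D T : out_tree D T ->
  exists2 r, r \in T.1 & forall v, v \in T.1 -> connect (tree_arc T) r v.
Proof.
case/and3P=> sT /and3P [oT _ aT] /cards1P [r Er].
have /setIdP [rT _] : r \in [set x in T.1 | indeg T x == 0] by rewrite Er set11.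
exists r => //; pose S := [set v in T.1 | ~~ connect (tree_arc T) r v].
pose f x := odflt x [pick y | (y, x) \in T.2].
have fP x : x \in S -> (f x, x) \in T.2.
  rewrite inE => /andP [xT nx]; rewrite /f; case: pickP => //= noy.
  case/negP: nx; suff /set1P -> : x \in [set r] by [].
  rewrite -Er inE xT; apply/eqP/eqP; rewrite cards_eq0; apply/eqP/setP=> y.
  by rewrite !inE noy.
suff S0 : S = set0 by move=> v vT; move/setP/(_ v): S0; rewrite !inE vT /= => /negbFE.
have fS x : x \in S -> f x \in S.
  move=> xS; have [_ fxT _] := subdigraphP sT (fP x xS).
  move: (xS); rewrite !inE fxT /= => /andP [_]; apply: contra => rf.
  by apply: connect_trans rf (connect1 _); apply: (fP x xS).
apply: (@acyclic_no_successor T S f) => // x xS.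
- by rewrite /underlying fP ?orbT.
- by move=> E; have H := fP x xS; rewrite E in H; have := orientedP oT H; rewrite H.
move=> E; have := orientedP oT (fP x xS); case/negP.
by rewrite -{1}E; apply/fP/fS.
Qed.

(** Without leaves, a successor map on the whole tree would run into a cycle. *)
Lemma out_tree_leaf D T : out_tree D T -> 0 < #|leaves T|.
Proof.
case/and3P=> sT /and3P [oT /andP [nT _] aT] _; rewrite lt0n cards_eq0.
apply: contra nT => /eqP L0; apply/eqP.
pose f x := odflt x [pick y | (x, y) \in T.2].
have fP x : x \in T.1 -> (x, f x) \in T.2.
  move=> xT; rewrite /f; case: pickP => //= noy.
  have : x \in leaves T; last by rewrite L0 inE.
  by rewrite inE xT cards_eq0; apply/eqP/setP=> y; rewrite !inE noy.
have fT x : x \in T.1 -> f x \in T.1 by move=> /fP /(subdigraphP sT) [].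
apply: (@acyclic_no_successor T T.1 f) => // x xT.
- by rewrite /underlying fP.
- by move=> E; have := fP x xT; rewrite E => H; have := orientedP oT H; rewrite H.
move=> E; have := orientedP oT (fP x xT); case/negP.
by rewrite -{2}E; apply/fP/fT.
Qed.

Lemma out_tree1 D r : out_tree D ([set r], set0).
Proof.
apply/and3P; split.
- by apply/forall_inP=> a; rewrite inE.
- apply/and3P; split.
  + by apply/forall_inP=> a; rewrite inE.
  + apply/andP; split; first by apply/set0Pn; exists r; rewrite set11.
    by apply/forall_inP=> x /set1P ->; apply/forall_inP=> y /set1P ->; apply: connect0.
  + apply/forallP=> m; apply/forallP=> -[[|x [|y c]] sz]; apply/implyP;
      rewrite /ucycleb /= /underlying ?inE //= => _; by rewrite -(eqP sz).
- apply/cards1P; exists r; apply/setP=> x; rewrite !inE.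
  case: (x == r) => //=; rewrite cards_eq0; apply/eqP/setP=> y; by rewrite !inE.
Qed.

Definition graft T v w : graph_data V := (w |: T.1, (v, w) |: T.2).

Lemma graft_out_tree D T v w :
  out_tree D T -> v \in T.1 -> w \notin T.1 -> D v w -> out_tree D (graft T v w).
Proof.
case/and3P=> sT /and3P [oT /andP [nT cT] aT] rT vT wT vw.
have nw x : ((x, w) \in T.2 = false) * ((w, x) \in T.2 = false).
  by split; apply: contraNF wT => /(subdigraphP sT) [].
have vNw : v != w by apply: contraNneq wT => <-.
have undE x y : underlying (graft T v w) x y =
    [|| underlying T x y, (x == v) && (y == w) | (x == w) && (y == v)].
  rewrite /underlying !inE !xpair_eqE [(y == v) && _]andbC.
  by case: ((x, y) \in _); case: ((y, x) \in _);
     case: ((x == v) && _); case: ((x == w) && _).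
have sub : subrel (underlying T) (underlying (graft T v w)).
  by move=> x y; rewrite undE => ->.
have con x : x \in (graft T v w).1 -> connect (underlying (graft T v w)) x v.
  case/setU1P=> [->|xT]; first by apply: connect1; rewrite undE !eqxx !orbT.
  apply: connect_sub (forall_inP (forall_inP cT x xT) v vT) => a b /sub; exact: connect1.
have usym : connect_sym (underlying (graft T v w)).
  by apply: sym_connect_sym => x y; rewrite /underlying orbC.
apply/and3P; split.
- apply/forall_inP=> -[a b] /setU1P [[-> ->]|/(subdigraphP sT) [H1 H2 H3]] /=.
    by rewrite vw !inE eqxx vT orbT.
  by rewrite H1 !inE H2 H3 !orbT.
- apply/and3P; split.
  + apply/forall_inP=> -[a b] /setU1P [[-> ->]|H] /=.
      by rewrite !inE xpair_eqE nw (negPf vNw) andbF.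
    rewrite !inE negb_or (orientedP oT H) andbT xpair_eqE.
    by apply/negP=> /andP [_ /eqP E]; move: H; rewrite E nw.
  + apply/andP; split; first by apply/set0Pn; exists w; rewrite setU11.
    apply/forall_inP=> x xT; apply/forall_inP=> y yT.
    by apply: connect_trans (con x xT) _; rewrite usym con.
  + apply/forallP=> m; apply/forallP=> c; apply/implyP=> /andP [cyc uc].
    case: (boolP (w \in c)) => wc; last first.
      apply: (implyP (forallP (forallP aT m) c)); rewrite /ucycleb uc andbT.
      have {}wc : all (predC1 w) c by apply/allP=> z zc; apply: contraNneq wc => <-.
      apply: sub_in_cycle wc cyc => x y /= xw yw.
      by rewrite undE (negPf xw) (negPf yw) !(andbF, orbF).
    (* A cycle through [w] is rotated to start at [w]. Since [v] is the only neighbour of [w], the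
       second and the last vertex both equal [v], which a repetition-free cycle of size at least 3
       forbids. *)
    rewrite -(size_tuple c); case/rot_to: wc => i s Es.
    rewrite -(size_rot i) Es; move: cyc; rewrite -(rot_cycle i) Es.
    move: uc; rewrite -(rot_uniq i) Es; case: s {Es} => [|a [|b s]] //.
    have wn z : underlying (graft T v w) w z -> z = v.
      by rewrite undE /underlying !nw eqxx [w == v]eq_sym (negPf vNw) /= => /eqP.
    have nws z : underlying (graft T v w) z w -> z = v.
      rewrite undE /underlying !nw eqxx [w == v]eq_sym (negPf vNw).
      by rewrite /= andbT andbF orbF => /eqP.
    rewrite /= rcons_path => /and3P [_ anot _] /and4P [/wn av _ _ /nws lv].
    by case/negP: anot; rewrite av -lv mem_last.
- have /cards1P [r Er] := rT; apply/cards1P; exists r; rewrite -Er; apply/setP=> x.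
  rewrite !inE; case: (eqVneq x w) => [->|xw] /=.
    rewrite (negPf wT) /=; apply/negbTE; rewrite cards_eq0; apply/set0Pn; exists v.
    by rewrite !inE eqxx.
  congr (_ && (_ == _)); apply: eq_card => y; by rewrite !inE xpair_eqE (negPf xw) andbF.
Qed.

Definition boundary D I : {set V} := [set w | [exists v in I, D v w]] :\: I.

Definition within D I : rel V := fun x y => [&& x \in I, y \in I & D x y].

Definition out_connected D r I : Prop :=
  r \in I /\ forall v, v \in I -> connect (within D I) r v.

Lemma boundaryP D I w :
  reflect (w \notin I /\ exists2 v, v \in I & D v w) (w \in boundary D I).
Proof.
rewrite !inE; apply: (iffP andP) => [[-> /exists_inP //]|[-> H]].
by split=> //; apply/exists_inP.
Qed.

(* A maximal tree with internal vertices in I covers I and its boundary. *)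
Lemma out_connected_tree D r I : out_connected D r I ->
  exists T, [/\ out_tree D T, T.1 = I :|: boundary D I
    & forall x y, (x, y) \in T.2 -> x \in I].
Proof.
move=> [rI conn].
pose P T := [&& out_tree D T, r \in T.1 & [forall a in T.2, a.1 \in I]].
have P0 : P ([set r], set0).
  by rewrite /P out_tree1 set11; apply/forall_inP=> a; rewrite inE.
have [T /and3P [tT rT sI] Tmax] := arg_maxnP (fun T => #|T.1|) P0.
have ext v w : v \in T.1 -> v \in I -> D v w -> w \in T.1.
  move=> vT vI vw; apply: contraT => wT.
  have : P (graft T v w).
    rewrite /P graft_out_tree //= setU1r //=.
    by apply/forall_inP=> a /setU1P [->|/(forall_inP sI)].
  by move/Tmax; rewrite /= cardsU1 wT; lia.
have IT v : v \in I -> v \in T.1.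
  move/conn/connectP=> [p pP ->]; elim: p r rT rI pP {Tmax P P0 conn} => //= x p IH r rT rI.
  by case/andP=> /and3P [_ xI rx] /IH; apply=> //; apply: ext rx.
exists T; split=> //; last by move=> x y /(forall_inP sI).
apply/setP=> w; rewrite in_setU; apply/idP/orP => [wT|[/IT //|/boundaryP [_ [v vI /ext]]]]; last first.
  by apply=> //; apply: IT.
case: (boolP (w \in I)) => wI; [by left | right; apply/boundaryP; split=> //].
case/and3P: tT => sT /and3P [_ /andP [_ cT] _] _.
(* The first edge of an undirected path from [w] to [r] cannot leave [w], since tails of arcs lie in
   [I]; so it enters [w] from a vertex of [I]. *)
case/connectP: (forall_inP (forall_inP cT w wT) r rT) => -[|x p] /=.
  by move=> _ E; rewrite -E rI in wI.
case/andP=> /orP [] H _ _.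
  by rewrite (forall_inP sI _ H) in wI.
by exists x; [exact: (forall_inP sI _ H) | case: (subdigraphP sT H)].
Qed.

(** Given a tree, [I] consists of its non-leaves and its leaves lie on the boundary. Conversely the
    tree of [out_connected_tree] has all of the boundary as leaves, as its arcs start in [I]. For
    [k = 1] the equivalence fails on a digraph with a single vertex. *)
Lemma ell_ge_internal D k : 1 < k ->
  k <= ell D <-> exists r I, out_connected D r I /\ k <= #|boundary D I|.
Proof.
move=> k1; split=> [|[r [I [rI kI]]]]; last first.
  have [T [tT T1 sI]] := out_connected_tree rI.
  apply: leq_trans kI _; apply: leq_trans (leq_bigmax_cond _ tT).
  apply: subset_leq_card; apply/subsetP=> w wI; rewrite inE T1 in_setU wI orbT /=.
  rewrite cards_eq0; apply/eqP/setP=> x; rewrite !inE; apply/negP=> /sI.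
  by case/boundaryP: wI => /negPf ->.
case/(leq_bigmax_ex (ltnW k1))=> T0 tT0.
move=> kT; have [r rT conn] := out_tree_root tT0.
pose I := T0.1 :\: leaves T0.
have tI x y : (x, y) \in T0.2 -> x \in I /\ y \in T0.1.
  case/and3P: tT0 => sT _ _ H; have [_ xT yT] := subdigraphP sT H; split=> //.
  rewrite inE xT andbT inE xT /= -lt0n; apply/card_gt0P; exists y; by rewrite inE.
have arcs x y : (x, y) \in T0.2 -> D x y.
  by case/and3P: tT0 => sT _ _ /(subdigraphP sT) [].
have last_arc v : v \in T0.1 -> v != r -> exists2 u, (u, v) \in T0.2 & u \in I.
  move=> vT vr; case/connectP: (conn v vT) => p; case/lastP: p => [_ E|p x].
    by rewrite E eqxx in vr.
  by rewrite rcons_path last_rcons => /andP [_ H] ->; exists (last r p) => //; case: (tI _ _ H).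
have rI : r \in I.
  have [l lL lr] : exists2 l, l \in leaves T0 & l != r.
    have /card_gt1P [a [b [aL bL ab]]] := leq_trans k1 kT.
    by case: (eqVneq a r) ab => [-> rb|ar _]; [exists b; rewrite // eq_sym | exists a].
  (* A leaf other than the root exists by [1 < k]; the path to it starts with an arc out of [r], so
     [r] is no leaf. *)
  have lT : l \in T0.1 by case/setIdP: lL.
  case/connectP: (conn l lT) => -[|x p] /=.
    by move=> _ E; rewrite E eqxx in lr.
  by case/andP=> /tI [].
exists r, I; split; last first.
  apply: leq_trans kT _; apply/subset_leq_card/subsetP=> l lL.
  have lI : l \notin I by rewrite inE lL.
  apply/boundaryP; split=> //; case/setIdP: lL => lT _.
  have [|u ul uI] := last_arc l lT; first by apply: contraNneq lI => ->.
  by exists u => //; apply: arcs.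
split=> // v vI; have vT : v \in T0.1 by case/setDP: vI.
case/connectP: (conn v vT) vI => p pP -> {vT}.
suff: forall p x, path (tree_arc T0) x p -> last x p \in I ->
  x \in I /\ connect (within D I) x (last x p) by move=> H /(H _ _ pP) [].
elim=> [|y q IH] x //= /andP [xy /IH yp] /yp [yI yc].
have [xI _] := tI _ _ xy; split=> //; apply: connect_trans yc.
by apply: connect1; rewrite /within xI yI arcs.
Qed.

Lemma ell_gt0 D r : 0 < ell D.
Proof.
apply: leq_trans (leq_bigmax_cond _ (out_tree1 D r)).
exact: out_tree_leaf (out_tree1 D r).
Qed.

(** Every out-branching has a leaf, so positivity means existence. For the converse,
    [out_connected_tree] is applied to the full vertex set. *)
Lemma ell_s_gt0 D : 0 < ell_s D <-> exists r, forall v, connect D r v.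
Proof.
split=> [/(leq_bigmax_ex (ltn0Sn 0)) [T /andP [tT /eqP T1] _]|[r conn]].
  have [r _ conn] := out_tree_root tT; exists r => v.
  apply: connect_sub (conn v _); last by rewrite T1 inE.
  case/and3P: tT => sT _ _ x y /(subdigraphP sT) [xy _ _]; exact: connect1.
have [|T [tT T1 _]] := @out_connected_tree D r setT.
  split=> [|v _]; first by rewrite inE.
  by rewrite (eq_connect (e' := D)) // => x y; rewrite /within !inE.
have bT : out_branching D T by rewrite /out_branching tT T1 setTU eqxx.
by apply: leq_trans (leq_bigmax_cond _ bT); apply: out_tree_leaf tT.
Qed.

(** This is where membership in L enters: it turns an arbitrary out-tree with k leaves into an
    out-branching with k leaves. *)
Lemma ell_s_family_L D k : family_L D -> 0 < k ->
  k <= ell_s D <-> (exists r, forall v, connect D r v) /\ k <= ell D.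
Proof.
move=> LD k0; rewrite -ell_s_gt0; split=> [H|[pos kl]]; last first.
  by case: LD pos => [->|->].
split; first exact: leq_trans H.
have [T /andP [tT _] kT] := leq_bigmax_ex k0 H.
exact: leq_trans kT (leq_bigmax_cond _ tT).
Qed.

End OutTreeTheory.

(** * Correctness of the search *)

Lemma connect_ind_r (T : finType) (e : rel T) (x : T) (P : T -> Prop) :
  P x -> (forall y z, connect e x y -> P y -> e y z -> P z) ->
  forall y, connect e x y -> P y.
Proof.
move=> Px Pe y /connectP [p pP ->]; elim/last_ind: p pP => //= p z IH.
rewrite rcons_path last_rcons => /andP [pP pz]; apply: Pe pz; last exact: IH.
by apply/connectP; exists p.
Qed.

(** Inverts one bit read of [visit] with M = 2^L: reading [b] from h' leaves [h]. Divisibility says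
    that only the top bits of an L-bit number are in use, so shifting right loses nothing. *)
Lemma prepend_bit (b : bool) L m h : 0 < m <= L -> h < 2 ^ L ->
  2 ^ (L - m.-1) %| h ->
  exists h', [/\ h' < 2 ^ L, 2 ^ (L - m) %| h' & h' + h' = b * 2 ^ L + h].
Proof.
case: m => // m /= mL hL; rewrite (_ : L - m = (L - m.+1).+1); last lia.
rewrite expnSr => /dvdnP [q Eq]; exists (b * 2 ^ L.-1 + q * 2 ^ (L - m.+1)).
have EL : 2 ^ L = 2 * 2 ^ L.-1 by rewrite -expnS prednK //; lia.
split.
- case: b => /=; lia.
- apply: dvdn_add; last exact: dvdn_mull.
  by apply: dvdn_mull; apply: dvdn_exp2l; lia.
- case: b => /=; lia.
Qed.

Lemma card_ord_count n (P : pred nat) :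
  #|[set w : 'I_n | P w]| = count P (iota 0 n).
Proof. by rewrite -val_enum_ord count_map cardsE cardE enumT size_filter. Qed.

Lemma downto_const (A : Type) (f : A -> A) m a :
  downto (fun _ => f) m a = iter m f a.
Proof. by elim: m a => //= m IH a; rewrite IH -iterSr. Qed.

Lemma count_iotaS (P : pred nat) m :
  count P (iota 0 m.+1) = count P (iota 0 m) + P m.
Proof. by rewrite -[m.+1]addn1 iotaD count_cat /= add0n addn0. Qed.

Lemma downto_count (p q : pred nat) m c :
  downto (fun i c => (c.1 + p i, c.2 + q i)) m c =
  (c.1 + count p (iota 0 m), c.2 + count q (iota 0 m)).
Proof.
elim: m c => [|m IH] [a b]; first by rewrite /= !addn0.
rewrite [LHS]/= IH !count_iotaS /=; congr pair; lia.
Qed.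

Lemma tallyE n st : tally n st =
  (#|[set v : 'I_n | st v == 0]|, #|[set v : 'I_n | 0 < st v < 3]|).
Proof.
rewrite /tally (downto_count (fun i => st i == 0) (fun i => 0 < st i < 3)) !add0n.
by rewrite !(card_ord_count _ (fun v => st v == 0), card_ord_count _ (fun v => 0 < st v < 3)).
Qed.

Section Search.
Variables (n : nat) (D : digraph 'I_n) (adj : nat -> nat -> bool).
Hypothesis adjE : forall i j : 'I_n, adj i j = D i j.
Implicit Types (st : nat -> nat) (r u v w : 'I_n) (I : {set 'I_n}).

Definition fresh st v : {set 'I_n} := [set w | D v w & st w == 0].

Lemma downto_discover v m st c l :
  let s := downto (discover adj v) m (st, c, l) in
  let P := (fun i => adj v i && (st i == 0)) in
  [/\ forall i, s.1.1 i = if (i < m) && P i then 1 else st i,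
      s.1.2 = c + count P (iota 0 m) &
      s.2 = l /\ count P (iota 0 m) = 0 \/
      exists i, [/\ i < m, P i & s.2 = i.+1]].
Proof.
elim: m st c l => [|m IH] st c l; first by split=> //; [rewrite addn0 | left].
move=> s P; rewrite count_iotaS {}/s [downto _ _ _]/= -/(P m).
case: (boolP (P m)) => [Pm|nPm]; last first.
  have [A B C] := IH st c l; split.
  - move=> w; rewrite A ltnS; case: (ltngtP w m) => [//|//|->].
    by rewrite (negPf nPm) andbF.
  - by rewrite B addn0.
  - rewrite addn0; case: C => [|[w [H1 H2 H3]]]; first by left.
    by right; exists w; split=> //; apply: ltnW.
have [A B C] := IH (upd st m 1) c.+1 m.+1.
have Eupd i : i < m -> upd st m 1 i = st i by move=> im; rewrite upd_ne //; lia.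
have Ec : count (fun i => adj v i && (upd st m 1 i == 0)) (iota 0 m) = count P (iota 0 m).
  by apply: eq_in_count => w; rewrite mem_iota => wm; rewrite Eupd //; lia.
split.
- move=> w; rewrite A ltnS; case: (ltngtP w m) => [wm|wm|->].
  + by rewrite Eupd.
  + by rewrite /= upd_ne //; lia.
  + by rewrite Pm /= upd_eq.
- by rewrite B Ec; lia.
- right; case: C => [[-> _]|[w [H1 H2 H3]]]; first by exists m.
  by exists w; rewrite Eupd // in H2; split=> //; apply: ltnW.
Qed.

Lemma expandP st v :
  [/\ forall w, (expand n adj st v).1 w =
        if w == v then 3 else if w \in fresh st v then 1 else st w,
      #|fresh st v| = 1 -> exists w, fresh st v = [set w] /\
        (expand n adj st v).2 = w.+1
    & #|fresh st v| <> 1 -> (expand n adj st v).2 = 0].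
Proof.
have := downto_discover v n (upd st v 3) 0 0.
rewrite /expand; case: (downto _ _ _) => [[st' c] l] [/= A B C].
have neq w : w != v -> (w : nat) <> v by move=> /eqP wv /val_inj.
(* The scan runs after [v] got status 3 whereas [fresh] refers to the old status; the two agree
   because [v] has no loop. *)
have Pf w : adj v w && (upd st v 3 w == 0) = (w \in fresh st v).
  rewrite inE adjE; case: (eqVneq w v) => [->|/neq wv]; last by rewrite upd_ne.
  by rewrite arc_irr.
have Ec : c = #|fresh st v|.
  rewrite B add0n -(@card_ord_count n); apply: eq_card => w.
  by rewrite [LHS]inE Pf.
split.
- move=> w; rewrite A ltn_ord Pf /=; case: (eqVneq w v) => [->|/neq wv].
    by rewrite inE arc_irr upd_eq.
  by rewrite upd_ne.
- move=> c1; rewrite Ec c1 /=; case: C => [[_]|[i [ilt Pi ->]]].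
    by rewrite -[count _ _]add0n -B Ec c1.
  exists (Ordinal ilt); split=> //; have := Pf (Ordinal ilt); rewrite /= Pi => /esym wf.
  by move/eqP/cards1P: c1 wf => [x ->] /set1P ->.
- move=> c1; rewrite Ec; case: (leqP _ 1) => // cle.
  case: C => [[-> //]|[i [ilt Pi _]]].
  have := Pf (Ordinal ilt); rewrite /= Pi => /esym wf.
  have : 0 < #|fresh st v| by apply/card_gt0P; exists (Ordinal ilt).
  by case: #|fresh st v| c1 cle => [|[]].
Qed.

Lemma fresh_self st v : v \notin fresh st v.
Proof. by rewrite inE arc_irr. Qed.

(** In the names below, status 1 is blue and status 2 is red; [border] contains both. *)
Definition internal st : {set 'I_n} := [set v : 'I_n | st v == 3].
Definition red st : {set 'I_n} := [set v : 'I_n | st v == 2].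
Definition border st : {set 'I_n} := [set v : 'I_n | 0 < st v < 3].
Definition unsettled st : {set 'I_n} := [set v : 'I_n | st v <= 1].

(** * Invariants of the search from a fixed root *)

Section Rooted.
Variable r : 'I_n.

(** The seen vertices are the root, the internal vertices and the out-neighbours of internal
    vertices. [good_pred] exempts the root, since nothing is internal at the start. *)
Record good st (cur : nat) : Prop := Good {
  good_le3 : forall v, st v <= 3;
  good_conn : forall v, st v = 3 -> connect (within D (internal st)) r v;
  good_pred : forall v, st v <> 0 -> v = r \/ exists2 u : 'I_n, st u = 3 & D u v;
  good_succ : forall u v, st u = 3 -> D u v -> st v <> 0;
  good_root : st r <> 0;
  good_cur : cur <> 0 -> exists2 v : 'I_n, cur = v.+1 & st v = 1
}.

Lemma connect_within_sub I I' v : I \subset I' ->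
  connect (within D I) r v -> connect (within D I') r v.
Proof.
move=> /subsetP II'; apply: connect_sub => x y /and3P [xI yI xy].
by apply: connect1; rewrite /within !II'.
Qed.

Lemma good_start h : good (start r h).1.1 (start r h).1.2.
Proof.
have st1 v : (start r h).1.1 v = (v == r).
  by rewrite /= /upd -val_eqE /=; case: eqP.
split=> [v|v|v|u v||]; rewrite ?st1.
- by case: eqP.
- by case: eqP.
- by case: eqP => // ->; left.
- by case: eqP.
- by rewrite eqxx.
- by move=> _; exists r => //; rewrite st1 eqxx.
Qed.

Lemma good_expand st cur v : good st cur -> st v = 1 ->
  good (expand n adj st v).1 (expand n adj st v).2.
Proof.
move=> [g3 gc gp gs gr _] v1; have [E c1 c0] := expandP st v.
set st' := (expand n adj st v).1 in E *.
have int3 w : st w = 3 -> st' w = 3.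
  by move=> w3; rewrite E inE w3; case: eqP => // _; rewrite andbF.
have sub : internal st \subset internal st'.
  by apply/subsetP=> w; rewrite !inE => /eqP /int3 ->.
have conn w : st w = 3 -> connect (within D (internal st')) r w.
  by move/gc; apply: connect_within_sub.
have conv : connect (within D (internal st')) r v.
  case: (gp v) => [|->|[u u3 uv]]; [by rewrite v1 | exact: connect0 |].
  apply: connect_trans (conn u u3) (connect1 _).
  by rewrite /within !inE int3 // E !eqxx.
have int_inv w : st' w = 3 -> w = v \/ st w = 3.
  by rewrite E; case: eqP => [->|_]; [left | case: ifP => // _ ->; right].
have seen w : st w <> 0 -> st' w <> 0.
  by rewrite E; case: eqP => // _ w0; case: ifP.
split.
- by move=> w; rewrite E; case: eqP => // _; case: ifP.
- by move=> w /int_inv [->|/conn].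
- move=> w w0; case: (eqVneq (st w) 0) => [w0'|/eqP /gp [->|[u u3 uw]]].
  + right; exists v; first by rewrite E eqxx.
    move: w0; rewrite E; case: eqP => [wv|_]; first by rewrite wv v1 in w0'.
    by rewrite w0' inE; case: (D v w).
  + by left.
  + by right; exists u => //; apply: int3.
- move=> u w /int_inv [->|u3] uw; last exact: seen (gs _ _ u3 uw).
  case: (eqVneq (st w) 0) => [w0|/eqP]; last exact: seen.
  by rewrite E inE uw w0; case: eqP.
- exact: seen.
- move=> cn; case: (eqVneq #|fresh st v| 1) => [/c1 [w [fw ->]]|/eqP /c0 //].
  exists w => //; rewrite E fw set11; case: eqP => // wv.
  by have := fresh_self st v; rewrite fw wv set11.
Qed.

Lemma good_red st v : good st 0 -> st v = 1 -> good (upd st v 2) 0.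
Proof.
move=> [g3 gc gp gs gr _] v1.
have E w : upd st v 2 w = if w == v then 2 else st w by rewrite /upd -val_eqE.
have E3 w : (upd st v 2 w = 3) <-> st w = 3.
  by rewrite E; case: eqP => // ->; rewrite v1.
have E0 w : (upd st v 2 w <> 0) <-> st w <> 0.
  by rewrite E; case: eqP => // ->; rewrite v1.
have Ei : internal (upd st v 2) = internal st.
  by apply/setP=> w; rewrite !inE; apply/eqP/eqP => /E3.
split=> //.
- by move=> w; rewrite E; case: eqP.
- by move=> w /E3 /gc; rewrite Ei.
- by move=> w /E0 /gp [|[u /E3 u3 uw]]; [left | right; exists u].
- by move=> u w /E3 u3 uw; apply/E0; apply: gs uw.
- exact/E0.
Qed.

(** [VisitExpand] covers both a forced vertex, which leaves [h] untouched, and a bit 1 taken off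
    [h]. *)
Variant visit_spec M st cur h : (nat -> nat) * nat * nat -> Prop :=
| VisitDone of cur = 0 & (forall v, st v <> 1) : visit_spec M st cur h (st, cur, h)
| VisitRed v of cur = 0 & st v = 1 & h + h < M :
    visit_spec M st cur h (upd st v 2, 0, h + h)
| VisitExpand v h' of st v = 1 &
    cur = v.+1 /\ h' = h \/ cur = 0 /\ h + h = M + h' :
    visit_spec M st cur h (expand n adj st v, h').

Lemma visitP M st cur h : good st cur ->
  visit_spec M st cur h (visit n adj M (st, cur, h)).
Proof.
move=> G; rewrite /visit; case: (posnP cur) => [c0|c0]; last first.
  have [|v -> v1] := good_cur G; first lia.
  by apply: VisitExpand => //; left.
case: (searchP n st) => [[-> no]|[i [-> ilt i1]]].
  by apply: VisitDone => // v; apply: no.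
pose v := Ordinal ilt; case: leqP => Mh; last exact: (@VisitRed _ _ _ _ v).
by apply: (@VisitExpand _ _ _ _ v) => //; right; rewrite subnKC.
Qed.

Lemma good_visit M st cur h : good st cur ->
  good (visit n adj M (st, cur, h)).1.1 (visit n adj M (st, cur, h)).1.2.
Proof.
move=> G; case: (visitP M h G) => [//|v c0 v1 _|v h' v1 _].
  by apply: good_red => //; rewrite -c0.
by case E : expand (good_expand G v1) => [st' c'].
Qed.

Lemma good_iter M j s : good s.1.1 s.1.2 ->
  good (iter j (visit n adj M) s).1.1 (iter j (visit n adj M) s).1.2.
Proof.
move=> G; elim: j => //= j; case: (iter j _ s) => [[st cur] h]; exact: good_visit.
Qed.

Lemma unsettled_expand st v : st v = 1 ->
  #|unsettled (expand n adj st v).1| < #|unsettled st|.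
Proof.
move=> v1; have [E _ _] := expandP st v.
rewrite [X in _ < X](cardsD1 v) inE v1 /= add1n ltnS.
apply/subset_leq_card/subsetP=> w; rewrite !inE E; case: eqP => // _ /=.
by case: ifP => //; rewrite inE => /andP [_ /eqP ->].
Qed.

Lemma unsettled_red st v : st v = 1 -> #|unsettled (upd st v 2)| < #|unsettled st|.
Proof.
move=> v1; rewrite [X in _ < X](cardsD1 v) inE v1 /= add1n ltnS.
apply/subset_leq_card/subsetP=> w; rewrite !inE /upd -val_eqE.
by case: ifP.
Qed.

Lemma iter_visit_no_blue M j st cur h : good st cur -> #|unsettled st| <= j ->
  forall v, (iter j (visit n adj M) (st, cur, h)).1.1 v <> 1.
Proof.
elim: j st cur h => [|j IH] st cur h G uj v.
  move: uj; rewrite leqn0 cards_eq0 => /eqP /setP /(_ v) /=.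
  by rewrite !inE => + E; rewrite E.
rewrite iterSr; have := good_visit M h G.
case: (visitP M h G) => [c0 no|w c0 w1 _|w h' w1 _] G'.
- elim: j {IH uj} => [|j IHj]; first exact: no.
  rewrite iterSr; case: (visitP M h G) => [//|w _ w1 _|w h' w1 _];
    by case: (no w).
- by apply: IH => //; rewrite -ltnS; apply: leq_trans (unsettled_red w1) uj.
- have := unsettled_expand w1; case E : expand G' => [st' c'] G' lt.
  by apply: IH => //; rewrite -ltnS; apply: leq_trans lt uj.
Qed.

(** Two border vertices are required because [good] does not make the root internal: one of them
    differs from [r], so it has an internal predecessor, and the path from [r] to that one shows
    that [r] is internal. *)
Lemma good_border st cur : good st cur -> 1 < #|border st| ->
  out_connected D r (internal st) /\ border st \subset boundary D (internal st).
Proof.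
move=> G /card_gt1P [a [b [aB bB ab]]].
have [w wB wr] : exists2 w, w \in border st & w != r.
  by case: (eqVneq a r) ab => [-> rb|ar _]; [exists b; rewrite // eq_sym | exists a].
have [u u3 uw] : exists2 u : 'I_n, st u = 3 & D u w.
  move: wB; rewrite inE => wB; case: (good_pred G (v := w)) => [|E|//]; first lia.
  by rewrite E eqxx in wr.
have rI : r \in internal st.
  case/connectP: (good_conn G u3) => -[|x p] /= => [_ <-|].
    by rewrite inE u3.
  by case/andP=> /and3P [].
split; first by split=> // v; rewrite inE => /eqP /(good_conn G).
apply/subsetP=> v; rewrite inE => vB; apply/boundaryP.
have vI : v \notin internal st by rewrite inE; lia.
split=> //; case: (good_pred G (v := v)) => [|E|[x x3 xv]]; first lia.
  by rewrite E rI in vI.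
by exists x; rewrite // inE x3.
Qed.

(** Any [M] and [h] will do: a wrong guess can miss a good set but never invent one. *)
Lemma explore_sound M h k : 1 < k -> k <= (tally n (explore n adj M r h)).2 ->
  exists I, out_connected D r I /\ k <= #|boundary D I|.
Proof.
rewrite tallyE /explore downto_const /= -/(border _) => k1 kB.
have G := good_iter M n (good_start h).
have [A B] := good_border G (leq_trans k1 kB).
by eexists; split; [exact: A | apply: leq_trans kB (subset_leq_card B)].
Qed.

(** With M = 0 nothing turns red, and after [n] rounds nothing is blue. So all seen vertices are
    internal, and they are closed under out-neighbours. *)
Lemma explore_reach : reaches_all n adj r <-> forall v, connect D r v.
Proof.
rewrite /reaches_all tallyE /explore downto_const /=.
have G := good_iter 0 n (good_start 0).
have nored : forall v, (iter n (visit n adj 0) (start r 0)).1.1 v <> 2.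
  have : forall v, (start r 0).1.1 v <> 2.
    by move=> v; rewrite /= /upd; case: ifP.
  suff: forall j s, good s.1.1 s.1.2 -> (forall v, s.1.1 v <> 2) ->
    forall v, (iter j (visit n adj 0) s).1.1 v <> 2 by apply; apply: good_start.
  elim=> // j IH [[st cur] h] G0 no.
  rewrite iterSr; apply: IH; first exact: good_visit.
  case: (visitP 0 h G0) => [//|v _ _|v h' v1 _ w]; first lia.
  have [E _ _] := expandP st v; case: expand E => st' c' /= ->.
  by case: eqP => // _; case: ifP.
have noblue := @iter_visit_no_blue 0 n _ _ 0 (good_start 0)
  (leq_trans (max_card _) (eq_leq (card_ord n))).
rewrite -/(start r 0) in noblue.
case: (iter n _ _) G nored noblue => [[st cur] h] /= G nored noblue.
split=> [/eqP S0 v|conn].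
  have v0 : st v <> 0 by move=> E; move/eqP: S0; rewrite cards_eq0 => /eqP /setP /(_ v); rewrite !inE E.
  have sub x : connect (within D (internal st)) r x -> connect D r x.
    by apply: connect_sub => y z /and3P [_ _ yz]; apply: connect1.
  case: (good_pred G v0) => [->|[u u3 uv]]; first exact: connect0.
  by apply: connect_trans (connect1 uv); apply/sub/(good_conn G).
have all3 v : st v <> 0 -> st v = 3.
  by have := good_le3 G v; have := nored v; have := noblue v; lia.
rewrite cards_eq0; apply/eqP/setP=> v; rewrite !inE.
suff: st v = 3 by lia.
apply: (connect_ind_r (P := fun w => st w = 3) _ _ (conn v)) => [|x y _ x3 xy].
  exact: all3 (good_root G).
exact: all3 (good_succ G x3 xy).
Qed.

(** * Completeness: some guess leads to k leaves *)

Section Completeness.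
Variable k : nat.
Hypothesis k_gt1 : 1 < k.

Definition solution st I : Prop :=
  [/\ out_connected D r I, internal st \subset I,
      forall v, st v = 2 -> v \notin I & k <= #|boundary D I|].

(** Membership in every solution, not just in one, so that expanding the vertex keeps all solutions
    and the exchange argument applies to each of them. *)
Definition forced st cur : Prop :=
  forall v, cur = v.+1 -> forall I, solution st I -> v \in I.

(** The exchange step. Out-neighbours of [v] that are not fresh are the root or have an internal
    predecessor, so they do not depend on [v]. The boundary loses at most the fresh vertex and gains
    [v], which itself has an internal predecessor. *)
Lemma solution_remove st cur v I : good st cur -> st r = 3 -> st v = 1 ->
  solution st I -> v \in I -> [disjoint fresh st v & I] -> #|fresh st v| <= 1 ->
  solution st (I :\ v).
Proof.
move=> G r3 v1 [[rI conn] intI redI kI] vI dis f1.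
have neq w : st w <> 1 -> w != v by move=> w1; apply: contra_notN w1 => /eqP ->.
have pred w : D v w -> w \notin fresh st v -> w = r \/ exists2 u : 'I_n, st u = 3 & D u w.
  by move=> vw; rewrite inE vw /= => /eqP /(good_pred G).
have int_sub : internal st \subset I :\ v.
  apply/subsetP=> w wI; rewrite !inE (subsetP intI) // andbT neq //.
  by move: wI; rewrite inE => /eqP ->.
have intE w : st w = 3 -> w \in I :\ v by move=> w3; apply: (subsetP int_sub); rewrite inE w3.
split=> //.
- split; first exact: intE.
  move=> w; rewrite !inE => /andP [wv wI].
  suff: w != v -> connect (within D (I :\ v)) r w by apply.
  apply: (connect_ind_r (P := fun w => w != v -> connect (within D (I :\ v)) r w) _ _ (conn w wI)).
    by move=> _; apply: connect0.
  move=> x y _ IH /and3P [xI yI xy] yv.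
  (* A path step out of [v] is rerouted: its head lies in [I], hence is not fresh, and is the root
     or has an internal predecessor. *)
  case: (eqVneq x v) => [xv|xv]; last first.
    apply: connect_trans (IH xv) (connect1 _).
    by rewrite /within !inE xv xI yv yI.
  rewrite xv in xy; case: (pred y xy) => [|->|[u u3 uy]].
  + by apply/negP=> yf; move: (disjointFr dis yf); rewrite yI.
  + exact: connect0.
  + apply: connect_trans (connect_within_sub int_sub (good_conn G u3)) (connect1 _).
    by rewrite /within (intE u) // !inE yv yI.
- by move=> w /redI; rewrite !inE negb_and => ->; rewrite orbT.
have sub : v |: (boundary D I :\: fresh st v) \subset boundary D (I :\ v).
  apply/subsetP=> w /setU1P [->|/setDP [/boundaryP [wI [u uI uw]] wf]]; apply/boundaryP.
    split; first by rewrite !inE eqxx.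
    case: (good_pred G (v := v)) => [|E|[u u3 uv]]; first by rewrite v1.
      by rewrite E r3 in v1.
    by exists u => //; apply: intE.
  split; first by rewrite !inE (negPf wI) andbF.
  case: (eqVneq u v) => [uv|uv]; last by exists u; rewrite // !inE uv uI.
  rewrite uv in uw; case: (pred w uw wf) => [E|[x x3 xw]]; first by rewrite E rI in wI.
  by exists x => //; apply: intE.
apply: leq_trans (subset_leq_card sub); rewrite cardsU1.
have -> : v \notin boundary D I :\: fresh st v.
  by rewrite inE negb_and; apply/orP; right; apply/negP=> /boundaryP []; rewrite vI.
have H := cardsID (fresh st v) (boundary D I).
have : #|boundary D I :&: fresh st v| <= 1 by apply: leq_trans f1; apply/subset_leq_card/subsetIr.
by move: kI; rewrite -H; move: #|_ :&: _| #|_ :\: _| => a b; lia.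
Qed.

Lemma border_expand st v : st v = 1 ->
  #|border (expand n adj st v).1| = (#|border st|).-1 + #|fresh st v|.
Proof.
move=> v1; have [E _ _] := expandP st v.
have -> : border (expand n adj st v).1 = (border st :\ v) :|: fresh st v.
  apply/setP=> w; rewrite !inE E; case: (eqVneq w v) => [->|wv] /=.
    by rewrite arc_irr.
  rewrite inE; case: ifP => [_|]; first by rewrite orbT.
  by rewrite orbF.
rewrite cardsU (cardsD1 v (border st)) [v \in border st]inE v1 /=.
suff -> : (border st :\ v) :&: fresh st v = set0 by rewrite cards0 subn0.
by apply/setP=> w; rewrite !inE; case: (st w == 0) / eqP => [->|]; rewrite ?andbF.
Qed.

Lemma red_expand st v : st v = 1 -> red (expand n adj st v).1 = red st.
Proof.
move=> v1; have [E _ _] := expandP st v; apply/setP=> w; rewrite !inE E.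
case: (eqVneq w v) => [->|_]; first by rewrite v1.
by case: ifP => //; rewrite inE => /andP [_ /eqP ->].
Qed.

Lemma solution_expand st v I : st v = 1 ->
  solution (expand n adj st v).1 I <-> solution st I /\ v \in I.
Proof.
move=> v1; have [E _ _] := expandP st v.
have Ei : internal (expand n adj st v).1 = v |: internal st.
  apply/setP=> w; rewrite !inE E; case: (eqVneq w v) => //= _.
  by case: ifP => //; rewrite inE => /andP [_ /eqP ->].
have Er w : ((expand n adj st v).1 w = 2) <-> (st w = 2).
  by have /setP /(_ w) := red_expand v1; rewrite !inE => H; split=> /eqP W; apply/eqP; rewrite ?H // -H.
rewrite /solution Ei subUset sub1set; split.
  by case=> A /andP [B C] F H; split=> //; split=> // w /Er; apply: F.
by case=> -[A B F H] C; split; rewrite ?C // => w /Er; apply: F.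
Qed.

(** By [solution_remove], a solution that avoids all fresh vertices would, with at most one of them,
    yield a solution without [v]. Hence some vertex is fresh, and a single fresh vertex lies in
    every solution. *)
Lemma forced_expand st cur v : good st cur -> st r = 3 -> st v = 1 ->
  (exists I, solution st I) -> (forall I, solution st I -> v \in I) ->
  let s := expand n adj st v in
  [/\ exists I, solution s.1 I, forced s.1 s.2
    & s.2 <> 0 /\ #|border s.1| = #|border st| \/
      s.2 = 0 /\ #|border st| < #|border s.1|].
Proof.
move=> G r3 v1 [I0 sol0] vI s.
have sol_s I : solution s.1 I <-> solution st I.
  by rewrite solution_expand //; split=> [[]|H] //; split=> //; apply: vI.
have no_remove I : solution st I -> [disjoint fresh st v & I] -> 1 < #|fresh st v|.
  move=> sI dis; rewrite ltnNge; apply/negP=> f1.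
  by have /vI := solution_remove G r3 v1 sI (vI _ sI) dis f1; rewrite !inE eqxx.
have b0 : 0 < #|border st| by apply/card_gt0P; exists v; rewrite inE v1.
have [_ c1 c0] := expandP st v; rewrite -/s in c1 c0.
have bE := border_expand v1; rewrite -/s in bE.
split; first by exists I0; apply/sol_s.
- move=> w sw I /sol_s sI; apply/negPn/negP => wI.
  case: (eqVneq #|fresh st v| 1) => [f1|/eqP /c0]; last by rewrite sw.
  have [x [fx sx]] := c1 f1.
  have xw : x = w by apply/val_inj; move: sx; rewrite sw => -[].
  have : 1 < #|fresh st v|; last by rewrite f1.
  by apply: (no_remove I) => //; rewrite fx xw disjoints1.
- case: (eqVneq #|fresh st v| 1) => [f1|/eqP f1].
    by left; have [x [_ ->]] := c1 f1; split=> //; rewrite bE f1; move: b0; case: #|border st| => // b _; rewrite addn1.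
  right; split; first exact: c0.
  have : 0 < #|fresh st v|.
    rewrite lt0n; apply/negP=> /eqP f0.
    have : 1 < #|fresh st v|; last by rewrite f0.
    apply: (no_remove I0) => //; move/eqP: f0; rewrite cards_eq0 => /eqP ->.
    by rewrite -setI_eq0 set0I.
  rewrite bE; move: b0 f1; case: #|border st| => // b _.
  by case: #|fresh st v| => [|[|f]] //= _ _; lia.
Qed.

(** Starting from [r], a solution can only step to seen vertices that are neither red nor blue, so
    it is contained in the internal set. *)
Lemma no_blue_solution st cur I : good st cur -> st r = 3 ->
  (forall v, st v <> 1) -> solution st I -> k <= #|border st|.
Proof.
move=> G r3 no [[rI conn] intI redI kI]; apply: leq_trans kI _.
have I3 w : w \in I -> st w = 3.
  move=> wI; apply: (connect_ind_r (P := fun w => st w = 3) _ _ (conn w wI)) => //.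
  move=> x y _ x3 /and3P [_ yI xy].
  have := good_succ G x3 xy; have := good_le3 G y; have := no y.
  have : st y <> 2 by move/redI; rewrite yI.
  lia.
apply/subset_leq_card/subsetP=> w /boundaryP [wI [u /I3 u3 uw]]; rewrite inE.
have := good_succ G u3 uw; have := good_le3 G w.
have : st w <> 3 by move=> w3; case/negP: wI; apply: (subsetP intI); rewrite inE w3.
lia.
Qed.

Lemma border_red st v : st v = 1 -> border (upd st v 2) = border st.
Proof.
move=> v1; apply/setP=> w; rewrite !inE /upd; case: eqP => // /val_inj ->.
by rewrite v1.
Qed.

(** With nothing forced and only zero bits left, rounds merely turn blue vertices red, so a border
    that is already large enough is kept. *)
Lemma border_iter_zero M j st : 0 < M -> good st 0 ->
  border (iter j (visit n adj M) (st, 0, 0)).1.1 = border st.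
Proof.
move=> M0; elim: j st => // j IH st G; rewrite iterSr.
have := good_visit M 0 G.
case: (visitP M 0 G) => [_ no|v _ v1 _ G'|v h' v1 [[]|[_]] //]; first by move=> _; apply: IH.
  by rewrite IH ?border_red.
by lia.
Qed.

(** Supplies the case distinction that determines a bit of the guess. *)
Lemma solution_dec st : (exists I, solution st I) \/ ~ (exists I, solution st I).
Proof.
pose b I := [&& r \in I, [forall v in I, connect (within D I) r v],
  internal st \subset I, [forall v : 'I_n, (st v == 2) ==> (v \notin I)]
  & k <= #|boundary D I|].
have bP I : reflect (solution st I) (b I).
  apply: (iffP and5P) => [[A /forall_inP B C /forallP F H]|[[A B] C F H]].
    by split=> // v v2; have := F v; rewrite v2.
  by split=> //; [apply/forall_inP | apply/forallP=> v; apply/implyP=> /eqP /F].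
by case: (pickP b) => [I /bP|no]; [left; exists I | right=> -[I /bP]; rewrite no].
Qed.

Lemma upd_ord st c v w : upd st v c w = if w == v then c else st w.
Proof. by rewrite /upd -val_eqE. Qed.

Lemma red_red st v : st v = 1 -> red (upd st v 2) = v |: red st.
Proof. by move=> v1; apply/setP=> w; rewrite !inE upd_ord; case: (eqVneq w v). Qed.

Lemma red_border st : #|red st| <= #|border st|.
Proof. by apply/subset_leq_card/subsetP=> w; rewrite !inE => /eqP ->. Qed.

(* Each red vertex and each branching consumes one bit; the vertices of a path
   followed through [cur] are paid for by the branching at its end. *)
Lemma search_complete L j st cur m : good st cur -> st r = 3 ->
  #|unsettled st| <= j -> (exists I, solution st I) -> forced st cur ->
  (cur <> 0 -> #|border st| < k) ->
  (k - #|red st|) + (k - #|border st|) <= m + (cur != 0) -> m <= L ->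
  exists h, [/\ h < 2 ^ L, 2 ^ (L - m) %| h
    & k <= #|border (iter j (visit n adj (2 ^ L)) (st, cur, h)).1.1|].
Proof.
elim: j st cur m => [|j IH] st cur m G r3 uj [I0 sol0] Fc bc me mL.
  have no v : st v <> 1.
    move: uj; rewrite leqn0 cards_eq0 => /eqP /setP /(_ v) /=.
    by rewrite !inE => + E; rewrite E.
  exists 0; split; rewrite ?expn_gt0 ?dvdn0 //.
  exact: no_blue_solution G r3 no sol0.
(* Used for a forced vertex with m' = m and after reading a bit 1 with m' = m.-1. The extra unit in
   [m'.+1] is the one carried by [cur] or the bit just spent. *)
have expandI v m' : st v = 1 -> (forall I, solution st I -> v \in I) ->
    #|border st| < k -> (k - #|red st|) + (k - #|border st|) <= m'.+1 -> m' <= L ->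
    exists h, [/\ h < 2 ^ L, 2 ^ (L - m') %| h
      & k <= #|border (iter j (visit n adj (2 ^ L)) (expand n adj st v, h)).1.1|].
  move=> v1 vI bk me' mL'.
  have [ex Fs bs] := forced_expand G r3 v1 (ex_intro _ _ sol0) vI.
  have Gs := good_expand G v1.
  have rs : (expand n adj st v).1 r = 3.
    have [E _ _] := expandP st v; rewrite E; case: eqP => // _.
    by rewrite inE r3 andbF.
  have us : #|unsettled (expand n adj st v).1| <= j.
    by rewrite -ltnS; apply: leq_trans (unsettled_expand v1) uj.
  have Er := red_expand v1.
  case: (expand n adj st v) ex Fs bs Gs rs us Er => [st' c'] /= ex Fs bs Gs rs us Er.
  apply: IH => //; first by case: bs => -[c'0 bE] // _; rewrite bE.
  rewrite Er; case: bs => -[c'0 bE].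
    by rewrite bE (_ : (c' != 0) = true) ?addn1 //; apply/eqP.
  rewrite c'0 /= addn0; move: me' bE bk.
  move: #|red st| #|border st| #|border st'| => a b c; lia.
case: (posnP cur) => [c0|c0]; last first.
  have [|v cv v1] := good_cur G; first lia.
  have [||||h [hL hd hk]] := expandI v m v1.
  - exact: Fc.
  - by apply: bc; lia.
  - by move: me; rewrite cv /= addn1.
  - by [].
  by exists h; split=> //; rewrite iterSr cv.
(* Once the border has [k] vertices, all remaining bits are chosen 0. *)
case: (leqP k #|border st|) => bk.
  exists 0; split; rewrite ?expn_gt0 ?dvdn0 // c0 border_iter_zero ?expn_gt0 //.
  by rewrite -c0.
case: (searchP n st) => [[_ no]|[i [Es ilt i1]]].
  suff : k <= #|border st| by rewrite leqNgt bk.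
  by apply: (no_blue_solution G r3 _ sol0) => v; apply: no.
pose v := Ordinal ilt; have v1 : st v = 1 by [].
(* Red vertices belong to the border, so both terms of the potential are positive and a bit is
   available. *)
have rb := leq_ltn_trans (red_border st) bk.
rewrite c0 /= addn0 in me.
have m0 : 0 < m <= L.
  by rewrite mL andbT; move: me rb bk; move: #|red st| #|border st| => a b; lia.
(* The bit is 0 if some solution avoids [v]; otherwise [v] lies in every solution and can be treated
   as forced. *)
have [[I1 sol1]|nosol] := solution_dec (upd st v 2).
  have [||||||||h [hL hd hk]] := IH (upd st v 2) 0 m.-1.
  - by apply: good_red => //; rewrite -c0.
  - by rewrite /upd; case: eqP => // /val_inj E; rewrite -E r3 in v1.
  - by rewrite -ltnS; apply: leq_trans (unsettled_red v1) uj.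
  - by exists I1.
  - by [].
  - by [].
  - rewrite red_red // border_red // cardsU1 inE v1 /= addn0.
    by move: me rb bk m0; move: #|red st| #|border st| => a b; lia.
  - lia.
  have [h' [h'L h'd h'E]] := prepend_bit false m0 hL hd.
  exists h'; split=> //; rewrite iterSr c0 /visit /= Es.
  by rewrite h'E /= mul0n add0n (leqNgt (2 ^ L)) hL.
have [||||h [hL hd hk]] := expandI v m.-1 v1.
- move=> I [A B C E]; apply/negPn/negP=> vI; apply: nosol; exists I; split=> //.
    by apply: subset_trans B; apply/subsetP=> w; rewrite !inE upd_ord; case: (eqVneq w v).
  by move=> w; rewrite upd_ord; case: eqP => [-> //|_]; apply: C.
- by [].
- by case/andP: m0 => m0 _; rewrite prednK.
- lia.
have [h' [h'L h'd h'E]] := prepend_bit true m0 hL hd.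
exists h'; split=> //; rewrite iterSr c0 /visit /= Es h'E mul1n leq_addr.
by rewrite addKn.
Qed.

(** The root is expanded separately because the exchange argument presupposes it internal. Nothing
    is red afterwards, so the potential is at most 2k, and [2 ^ (2 * k)] is [4 ^ k]. *)
Lemma explore_complete I : out_connected D r I -> k <= #|boundary D I| ->
  exists2 h, h < 4 ^ k & k <= (tally n (explore n adj (4 ^ k) r h)).2.
Proof.
move=> conI kI; case: (conI) => rI conn.
pose st := (start r 0).1.1; have r1 : st r = 1 by rewrite /st /= upd_eq.
have st0 w : w != r -> st w = 0 by rewrite /st /= upd_ord => /negPf ->.
have G : good st r.+1 := good_start 0.
have Gs := good_expand G r1; have [E c1 c0] := expandP st r.
have us := unsettled_expand r1; have bs := border_expand r1.
have Es := red_expand r1; have sol J := solution_expand J r1.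
have freshE w : D r w -> w \in fresh st r.
  move=> rw; rewrite inE rw st0 //; apply: contraTneq rw => ->.
  by rewrite arc_irr.
have b1 : #|border st| = 1.
  apply/eqP/cards1P; exists r; apply/setP=> w; rewrite !inE.
  by case: eqVneq => [->|/st0 ->]; rewrite ?r1.
have red0 : #|red st| = 0.
  apply/eqP; rewrite cards_eq0; apply/eqP/setP=> w; rewrite !inE.
  by case: (eqVneq w r) => [->|/st0 ->]; rewrite ?r1.
have sI : solution st I.
  split=> //; first by apply/subsetP=> w; rewrite inE; case: (eqVneq w r) => [->|/st0 ->]; rewrite ?r1.
  by move=> w; case: (eqVneq w r) => [->|/st0 ->]; rewrite ?r1.
(* If r has a single out-neighbour outside J, then J = {r}. *)
have Fs : forced (expand n adj st r).1 (expand n adj st r).2.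
  move=> w sw J /sol [[[rJ connJ] _ _ kJ] _]; apply/negPn/negP=> wJ.
  case: (eqVneq #|fresh st r| 1) => [/c1 [x [fx sx]]|/eqP /c0]; last by rewrite sw.
  have xw : x = w by apply/val_inj; move: sx; rewrite sw => -[].
  have Jr y : y \in J -> y = r.
    move=> yJ; apply: (connect_ind_r (P := fun y => y = r) _ _ (connJ y yJ)) => //.
    move=> a b _ -> /and3P [_ bJ /freshE]; rewrite fx xw => /set1P Eb.
    by rewrite -Eb bJ in wJ.
  suff : #|boundary D J| <= 1 by rewrite leqNgt (leq_trans k_gt1 kJ).
  rewrite -(cards1 w); apply/subset_leq_card/subsetP=> y /boundaryP [_ [a /Jr -> /freshE]].
  by rewrite fx xw.
have rs : (expand n adj st r).1 r = 3 by rewrite E eqxx.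
have un : #|unsettled (expand n adj st r).1| <= n.-1.
  have : #|unsettled st| <= n by rewrite -[X in _ <= X](card_ord n) max_card.
  by move: us; move: #|unsettled st| #|unsettled (expand _ _ _ _).1| => a b; lia.
have ex : exists J, solution (expand n adj st r).1 J by exists I; apply/sol.
have cb : (expand n adj st r).2 <> 0 -> #|border (expand n adj st r).1| < k.
  by move=> c; rewrite bs b1; case: (eqVneq #|fresh st r| 1) => [->|/eqP /c0].
have [||h [hL _ hk]] := @search_complete (2 * k) n.-1 _ _ (2 * k) Gs rs un ex Fs cb.
- rewrite Es red0; lia.
- by [].
have M4 : 2 ^ (2 * k) = 4 ^ k by rewrite expnM.
rewrite M4 in hL hk; exists h => //.
rewrite tallyE /explore downto_const /= -/(border _).
have n0 : n = n.-1.+1 by rewrite prednK //; apply: leq_ltn_trans (ltn_ord r).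
have iter_n (A : Type) (F : A -> A) s : iter n F s = iter n.-1 F (F s).
  by rewrite {1}n0 iterSr.
by rewrite iter_n; rewrite -surjective_pairing in hk.
Qed.

End Completeness.

End Rooted.
End Search.

(** * The running time and the theorem *)

Lemma answerP n (D : digraph 'I_n) (adj : nat -> nat -> bool) k :
  (forall i j : 'I_n, adj i j = D i j) -> family_L D -> 0 < k ->
  answer n k adj = (k <= ell_s D).
Proof.
move=> adjE LD k0; apply/andP/idP; last first.
  case/(ell_s_family_L LD k0) => -[r rD] kl; split.
    apply/hasP; exists (val r); first by rewrite mem_iota ltn_ord.
    exact/(explore_reach adjE).
  case: (leqP k 1) => //= k1.
  have [r' [I [conI kI]]] := (ell_ge_internal D k1).1 kl.
  have [h hk hw] := explore_complete adjE k1 conI kI.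
  apply/hasP; exists (val r'); first by rewrite mem_iota ltn_ord.
  by apply/hasP; exists h; rewrite // mem_iota.
case=> /hasP [v]; rewrite mem_iota /= => vn rv win.
have rD := (explore_reach adjE (Ordinal vn)).1 rv.
apply/(ell_s_family_L LD k0); split; first by exists (Ordinal vn).
case: (leqP k 1) win => [k1 _|k1 /= /hasP [w]].
  exact: leq_trans k1 (ell_gt0 D (Ordinal vn)).
rewrite mem_iota => wn /hasP [h _ hw].
have [I [conI kI]] := explore_sound adjE (r := Ordinal wn) k1 hw.
by apply/ell_ge_internal => //; exists (Ordinal wn), I.
Qed.

Lemma nth_allpairs (A B : Type) (F : A -> B -> nat) s t a b i j :
  i < size s -> j < size t ->
  nth 0 [seq F x y | x <- s, y <- t] (i * size t + j) = F (nth a s i) (nth b t j).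
Proof.
elim: s i => [|x s IH] [|i] //= isz jsz; rewrite nth_cat size_map.
  by rewrite mul0n add0n jsz (nth_map b).
rewrite ifN; last by rewrite mulSn -leqNgt -addnA leq_addr.
by rewrite mulSn -addnA addKn IH.
Qed.

(** There are n roots, 4^k guesses for each and quadratic time per guess. The constants: 156 = 36 +
    80 + 40, 165 = 156 + 9, 165 + 156 + 8 + 3 <= 340, and 340 + 41 <= 400. *)
Lemma main_time_le n k : main_time n k <= 400 * 4 ^ k * maxn n 1 ^ 3.
Proof.
rewrite /main_time; set M := 4 ^ k; set N := maxn n 1.
have nN : n <= N by apply: leq_maxl.
have N1 : 1 <= N by apply: leq_maxr.
have M1 : 1 <= M by rewrite expn_gt0.
have kM : k <= M by apply/ltnW/ltn_expl.
rewrite !expnS expn0 muln1; set Q := N * N.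
have nQ : n * n <= Q by apply: leq_mul.
have NQ : N <= Q by rewrite /Q; nia.
have eQ : explore_time n <= 156 * Q by rewrite /explore_time; nia.
have Q1 : 1 <= Q by lia.
have MQ : M * (explore_time n + 9) <= 165 * (M * Q) by nia.
have Q2 : Q <= M * Q by nia.
have M2 : M <= M * Q by nia.
have body : M * (explore_time n + 9) + (explore_time n + 8) + 3 <= 340 * (M * Q) by lia.
have step : n * (M * (explore_time n + 9) + (explore_time n + 8) + 3) <= N * (340 * (M * Q)).
  exact: leq_mul.
have NMQ : M * Q <= N * (M * Q) by nia.
rewrite mulnCA in step; rewrite -[400 * M * _]mulnA (mulnCA M).
(* The products become variables, which leaves a linear goal. *)
move: step NMQ M2 Q2 nQ; move: (N * (M * Q)) (M * Q) (n * _) (n * n); lia.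
Qed.

Lemma computable_bound : computable (fun k => 400 * 4 ^ k).
Proof.
pose c := Ins (Const 1 1) ;; Ins (Read 2) ;; Ins (Const 0 400) ;;
  For 2 (Ins (Add 0 0 0) ;; Ins (Add 0 0 0)).
exists (compile 0 c) => k; exists (k * (2 + 3) + 5); apply: wp_outputs.
do 3!exec1; rewrite /=.
pose S a (r : nat -> nat) (_ : seq nat) := r 0 = a /\ r 1 = 1.
apply: (wp_weaken (T := k * (2 + 3) + 2)
  (Q := S (downto (fun _ b => b + b + (b + b)) k 400))); [|lia|]; last first.
  by move=> r u [-> _]; rewrite downto_quadruple mulnC.
apply: (@wp_for _ (fun _ b => b + b + (b + b)) S).
- by move=> a r u [].
- by move=> a r u v [A B]; split; upds.
- move=> i a r u _ [A B] E2; do 2!exec1; rewrite A.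
  by split; upds; rewrite // B.
- by split; upds.
- by upds.
Qed.

Theorem theorem4p2 :
  exists (p : program) (f : nat -> nat) (c : nat),
    computable f /\
    forall (n : nat) (D : digraph 'I_n) (k : nat),
      family_L D -> 0 < k ->
      outputs_within p (encode D k) (f k * maxn n 1 ^ c) (k <= ell_s D).
Proof.
exists (compile 0 main_cmd), (fun k => 400 * 4 ^ k), 3.
split=> [|n D k LD k0]; first exact: computable_bound.
rewrite /encode; set u := [seq _ | i <- _, j <- _].
(* The commands refer to a relation on all naturals; it is read off the encoded matrix. *)
pose adj i j := 0 < nth 0 u (i * n + j).
have uE (i j : 'I_n) : nth 0 u (i * n + j) = D i j.
  have := @nth_allpairs _ _ (fun i j => nat_of_bool (D i j)) (enum 'I_n) (enum 'I_n) i j i j.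
  by rewrite size_enum_ord !nth_ord_enum; apply.
have adjE (i j : 'I_n) : adj i j = D i j by rewrite /adj uE lt0b.
have su : size u = n * n by rewrite size_allpairs size_enum_ord.
have Hu i j : i < n -> j < n -> nth 0 u (i * n + j) = adj i j.
  by move=> ilt jlt; have := uE (Ordinal ilt) (Ordinal jlt); rewrite /adj /= => ->; case: (D _ _).
rewrite -(answerP adjE LD k0); apply: wp_outputs.
by apply: (wp_weaken (wp_main k0 su Hu)) => //; apply: main_time_le.
Qed.
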